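(* Let $K$ be a real closed field with a compatible, non-trivial non-archimedean absolute value. Let $S\subset K^n$ be a semialgebraic set with Zariski closure $X$ in $\mathbb{A}^n$, and let $A$ be the coordinate ring of $X$. Let $\mathscr{F}=(f_1,\dots,f_m)$ be a family of elements in $A$. Then $$\operatorname{trop}_{r,\mathscr{F}}(S_r^{\mathrm{an}})\cap\bigl(|K|_K^{\mathrm{sgn}}\bigr)^m=\operatorname{trop}_{r,\mathscr{F}}(S).$$
   Context: The absolute value $|\cdot|_K:K\to\mathbb{R}_{\ge0}$ is compatible with the unique order of $K$: $0\le a\le b$ implies $|a|_K\le|b|_K$. For $a\in K$, $|a|_K^{\mathrm{sgn}}=\operatorname{sgn}(a)|a|_K$, and $|K|_K^{\mathrm{sgn}}=\{|a|_K^{\mathrm{sgn}}:a\in K\}\subset\mathbb{R}$. A semialgebraic set in $K^n$ is a finite boolean combination of sets $\{f>0\}$, $f$ a polynomial over $K$. A signed $K$-seminorm on $A$ is a map $|\cdot|^{\mathrm{sgn}}:A\to\mathbb{R}$ with $|f|^{\mathrm{sgn}}=\operatorname{sgn}(f)|f|_K$ for $f\in K$, $|fg|^{\mathrm{sgn}}=|f|^{\mathrm{sgn}}|g|^{\mathrm{sgn}}$, and $\min(|f|^{\mathrm{sgn}},|g|^{\mathrm{sgn}})\le|f+g|^{\mathrm{sgn}}\le\max(|f|^{\mathrm{sgn}},|g|^{\mathrm{sgn}})$ for all $f,g\in A$. For a signed seminorm $x$ put $\operatorname{sgn}_x(f)=\operatorname{sgn}(|f|_x^{\mathrm{sgn}})$.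 The real analytification $S_r^{\mathrm{an}}$ of $S$ is the set of all signed $K$-seminorms $x$ on $A$ satisfying a semialgebraic description of $S$: if $S=\bigcup_i\{\xi:\operatorname{sgn}f_{ij}(\xi)=\epsilon_{ij}\ \forall j\}$ (finite), then $S_r^{\mathrm{an}}=\bigcup_i\{x:\operatorname{sgn}_x(f_{ij})=\epsilon_{ij}\ \forall j\}$ (independent of the description). For $x\in S_r^{\mathrm{an}}$, $\operatorname{trop}_{r,\mathscr{F}}(x)=(|f_1|_x^{\mathrm{sgn}},\dots,|f_m|_x^{\mathrm{sgn}})\in\mathbb{R}^m$; for $a\in S$, $\operatorname{trop}_{r,\mathscr{F}}(a)=(|f_1(a)|_K^{\mathrm{sgn}},\dots,|f_m(a)|_K^{\mathrm{sgn}})$ (the point $a$ corresponds to the signed seminorm $f\mapsto|f(a)|_K^{\mathrm{sgn}}$). *)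

(* Defs.v *)
From HB Require Import structures.
From mathcomp Require Import all_boot all_order all_algebra.
From mathcomp Require Import generic_quotient ring_quotient.
From mathcomp Require Import boolp classical_sets reals.
From mathcomp Require Import mpoly.

Set Implicit Arguments.
Unset Strict Implicit.
Unset Printing Implicit Defensive.

Import Order.TTheory GRing.Theory Num.Theory.
Local Open Scope ring_scope.
Local Open Scope classical_set_scope.
Local Open Scope quotient_scope.

Section AbsoluteValue.
Variables (R : realType) (K : rcfType).

Record nonarch_abs (v : K -> R) : Prop := NonarchAbs {
  nonarch_abs_ge0 : forall a, 0 <= v a;
  nonarch_abs_eq0 : forall a, v a = 0 <-> a = 0;
  nonarch_absM : forall a b, v (a * b) = v a * v b;
  nonarch_absD : forall a b, v (a + b) <= Num.max (v a) (v b)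
}.

Definition order_compatible (v : K -> R) : Prop :=
  forall a b, 0 <= a -> a <= b -> v a <= v b.

Definition nontrivial_abs (v : K -> R) : Prop :=
  exists a, a <> 0 /\ v a <> 1.

Definition signed_abs (v : K -> R) (a : K) : R := (sgz a)%:~R * v a.

End AbsoluteValue.

Section Semialgebraic.
Variables (K : rcfType) (n : nat).

(* The empty set is [set a | 0 < 0], so the nullary combinations are covered. *)
Inductive semialgebraic : set 'rV[K]_n -> Prop :=
| semialgebraic_pos (f : {mpoly K[n]}) :
    semialgebraic [set a : 'rV[K]_n | 0 < f.@[a 0]]
| semialgebraic_setC S : semialgebraic S -> semialgebraic (~` S)
| semialgebraic_setU S T :
    semialgebraic S -> semialgebraic T -> semialgebraic (S `|` T).

(* [:: [:: (f_11, e_11); ...]; ...] stands for the union over i of the sets   *)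
(* given by "sgn f_ij = e_ij for all j". An e_ij outside {-1, 0, 1} makes     *)
(* the i-th set empty.                                                        *)
Definition description := seq (seq ({mpoly K[n]} * int)).

Definition satisfies (sg : {mpoly K[n]} -> int) (D : description) : bool :=
  has (all (fun c => sg c.1 == c.2)) D.

Definition describes (D : description) (S : set 'rV[K]_n) : Prop :=
  S = [set a : 'rV[K]_n | satisfies (fun f => sgz f.@[a 0]) D].

Definition zariski_closure (S : set 'rV[K]_n) : set 'rV[K]_n :=
  [set a | forall p : {mpoly K[n]},
     (forall s : 'rV[K]_n, S s -> p.@[s 0] = 0) -> p.@[a 0] = 0].

End Semialgebraic.

Section CoordinateRing.
Variables (K : rcfType) (n : nat) (X : set 'rV[K]_n).

Definition vanishing_ideal : {pred {mpoly K[n]}} :=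
  fun p => `[< forall a : 'rV[K]_n, X a -> p.@[a 0] = 0 >].

Lemma vanishing_idealP (p : {mpoly K[n]}) :
  reflect (forall a : 'rV[K]_n, X a -> p.@[a 0] = 0) (p \in vanishing_ideal).
Proof. exact: asboolP. Qed.

Lemma vanishing_ideal_zmod_closed : zmod_closed vanishing_ideal.
Proof.
split; first by apply/vanishing_idealP => a _; rewrite meval0.
move=> p q /vanishing_idealP Ip /vanishing_idealP Iq.
by apply/vanishing_idealP => a Xa; rewrite mevalB Ip // Iq // subrr.
Qed.

HB.instance Definition _ :=
  GRing.isZmodClosed.Build {mpoly K[n]} vanishing_ideal
    vanishing_ideal_zmod_closed.

Lemma vanishing_idealMr p q : q \in vanishing_ideal -> p * q \in vanishing_ideal.
Proof.
move=> /vanishing_idealP Iq; apply/vanishing_idealP => a Xa.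
by rewrite mevalM Iq // mulr0.
Qed.

(* {ideal_quot _} cannot be used here: it only covers proper ideals, and      *)
(* the coordinate ring of the empty variety is the zero ring. Hence the       *)
(* additive quotient, equipped with its product below.                        *)
Definition coord_ring := Quotient.quot vanishing_ideal.

HB.instance Definition _ := GRing.Zmodule.on coord_ring.
HB.instance Definition _ := EqQuotient.on coord_ring.

Definition coord_proj (p : {mpoly K[n]}) : coord_ring := \pi p.

Lemma coord_projP p q :
  reflect (forall a : 'rV[K]_n, X a -> p.@[a 0] = q.@[a 0])
          (coord_proj p == coord_proj q).
Proof.
rewrite /coord_proj -Quotient.idealrBE.
apply: (iffP (vanishing_idealP _)) => E a Xa.
  by apply/eqP; rewrite -subr_eq0 -mevalB E.
by rewrite mevalB E // subrr.
Qed.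

Lemma coord_reprK (f : coord_ring) : coord_proj (repr f) = f.
Proof. exact: reprK. Qed.

Lemma coord_projD p q : coord_proj (p + q) = coord_proj p + coord_proj q.
Proof. exact: (@pi_addr _ _ _ _ _ (Quotient.quot vanishing_ideal)). Qed.

Definition coord_one : coord_ring := coord_proj 1.
Definition coord_mul (f g : coord_ring) : coord_ring :=
  coord_proj (repr f * repr g).

(* The value at a point of X is that of any representative. *)
Definition coord_eval (f : coord_ring) (a : 'rV[K]_n) : K := (repr f).@[a 0].

Lemma coord_eval_proj p (a : 'rV[K]_n) :
  X a -> coord_eval (coord_proj p) a = p.@[a 0].
Proof.
move=> Xa; rewrite /coord_eval; move: a Xa; apply/coord_projP.
by rewrite coord_reprK.
Qed.

Lemma coord_projM p q : coord_proj (p * q) = coord_mul (coord_proj p) (coord_proj q).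
Proof.
apply/eqP/coord_projP => a Xa.
by rewrite !mevalM -!/(coord_eval _ a) !coord_eval_proj.
Qed.

Lemma coord_mulA : associative coord_mul.
Proof.
move=> f g h; rewrite -[f]coord_reprK -[g]coord_reprK -[h]coord_reprK.
by rewrite -!coord_projM mulrA.
Qed.

Lemma coord_mulC : commutative coord_mul.
Proof. by move=> f g; rewrite /coord_mul mulrC. Qed.

Lemma coord_mul1 : left_id coord_one coord_mul.
Proof. by move=> f; rewrite -[f]coord_reprK -coord_projM mul1r. Qed.

Lemma coord_mulDl : left_distributive coord_mul +%R.
Proof.
move=> f g h; rewrite -[f]coord_reprK -[g]coord_reprK -[h]coord_reprK.
by rewrite -coord_projD -!coord_projM -coord_projD mulrDl.
Qed.

HB.instance Definition _ := GRing.Zmodule_isComPzRing.Build coord_ring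
  coord_mulA coord_mulC coord_mul1 coord_mulDl.

Definition coord_const (c : K) : coord_ring := coord_proj c%:MP.

End CoordinateRing.

Section RealAnalytification.
Variables (R : realType) (K : rcfType) (v : K -> R) (n : nat).

Record signed_seminorm (X : set 'rV[K]_n) (x : coord_ring X -> R) : Prop :=
  SignedSeminorm {
    signed_seminorm_const : forall c, x (coord_const X c) = signed_abs v c;
    signed_seminormM : forall f g, x (f * g) = x f * x g;
    signed_seminormD_min : forall f g, Num.min (x f) (x g) <= x (f + g);
    signed_seminormD_max : forall f g, x (f + g) <= Num.max (x f) (x g)
  }.

(* All descriptions D of S cut out the same set of signed seminorms, so       *)
(* "exists D" selects the same x as any fixed description of S.               *)
Definition real_analytification (S : set 'rV[K]_n) :
    set (coord_ring (zariski_closure S) -> R) :=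
  [set x | signed_seminorm x /\
     exists2 D : description K n, describes D S &
       satisfies (fun f => sgz (x (coord_proj (zariski_closure S) f))) D].

Variables (X : set 'rV[K]_n) (m : nat) (F : 'I_m -> coord_ring X).

Definition trop_an (x : coord_ring X -> R) : 'rV[R]_m := \row_j x (F j).

Definition trop_pt (a : 'rV[K]_n) : 'rV[R]_m :=
  \row_j signed_abs v (coord_eval (F j) a).

End RealAnalytification.

Arguments real_analytification {R K} v {n} S x.
Arguments trop_an {R K n X m} F x.
Arguments trop_pt {R K} v {n X m} F a.

(* Main.v *)
(* A signed seminorm x orders the coordinate ring, and this prime cone is       *)
(* realized by a point xi of a real closed field M. If x(f_j) = |c_j|^sgn with  *)
(* c_j != 0 then |f_j(xi) / c_j| = 1, so f_j(xi) / c_j lies strictly between    *)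
(* t^-1 and t for every t > 1 of K with |t| > 1. For a fixed t this is a finite *)
(* system of sign conditions, so quantifier elimination moves its solvability   *)
(* from M to K. The eliminated conditions are signs of finitely many univariate *)
(* polynomials in t, and these are the same at some t0 with |t0| <= 1 as at     *)
(* some t1 with |t1| > 1. A point a of K^n solving the system for t0 satisfies  *)
(* |f_j(a)| = |c_j|, because the bounds t0^-1 and t0 now confine |f_j(a) / c_j| *)
(* to 1.                                                                        *)
Require Import Defs.
From HB Require Import structures.
From mathcomp Require Import all_boot all_order all_algebra.
From mathcomp Require Import generic_quotient ring_quotient fraction closed_field.
From mathcomp Require Import polyrcf polyorder ring.
From mathcomp Require Import boolp classical_sets reals.
From mathcomp Require Import mpoly.

Set Implicit Arguments.
Unset Strict Implicit.
Unset Printing Implicit Defensive.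

Import Order.TTheory GRing.Theory Num.Theory.
Local Open Scope ring_scope.
Local Open Scope classical_set_scope.

(** * Partial order isomorphisms and signs of polynomials *)

(** A point a of S defines the seminorm taking f to |f(a)|^sgn, which gives one inclusion
    ([coord_eval_seminorm]). For the other inclusion, a seminorm x must be replaced by a point of
    K^n with prescribed values. Only signs survive that passage, so values are encoded as signs: a
    strict inequality x(h) < x(g) with x(g) positive forces g - h to be positive under x
    ([poly_seminorm_gt_sub]).

    Three results carry the argument. [prime_cone_realization] turns the signs under x into the
    signs of an actual point over a real closed field: the residue field of the cone is embedded in
    an algebraically closed field, and a maximal cone there spans a real closed subfield, as in
    Artin-Schreier theory. [transfer] moves a finite system of sign conditions between real closed
    fields once finitely many eliminated polynomials have the same signs in both. It follows Cohen
    and Hörmander: for a family closed under derivative, truncation and pseudo-remainder, the roots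
    in the two fields are matched in increasing order, by induction on the degree ([extend_match],
    [swept_all]), and the signs of the coefficients control every step.

    [sgz_constant_across_unit] uses the nontriviality of the absolute value: finitely many
    polynomials in t cannot separate |t| <= 1 from |t| > 1. Hence conditions that hold for x with a
    parameter of absolute value greater than 1 can be solved in K with a parameter of absolute value
    at most 1, where they pin absolute values exactly. [seminorm_approx] combines the three. *)

Section PartialIsomorphism.

Lemma seq_argmax (T : eqType) d (O : orderType d) (f : T -> O) (P : pred T) s :
  has P s -> exists a, [/\ a \in s, P a &
    forall z, z \in s -> P z -> (f z <= f a)%O].
Proof.
elim: s => //= x s IHs; have [/IHs [a [sa Pa maxa]] _|nPs] := boolP (has P s).
  have [Px|nPx] := boolP (P x); last first.
    exists a; split=> //; rewrite ?inE ?sa ?orbT // => z.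
    by rewrite inE => /predU1P[->|/maxa //]; rewrite (negPf nPx).
  have [le_xa|lt_ax] := leP (f x) (f a).
    exists a; split=> //; rewrite ?inE ?sa ?orbT // => z.
    by rewrite inE => /predU1P[->|/maxa].
  exists x; split=> //; rewrite ?mem_head // => z.
  by rewrite inE => /predU1P[->//|/maxa mz /mz /le_trans->//]; rewrite ltW.
rewrite orbF => Px; exists x; split=> //; rewrite ?mem_head // => z.
by rewrite inE => /predU1P[->//|sz Pz]; case/hasP: nPs; exists z.
Qed.

Lemma sgz_noroot (R : rcfType) (p : {poly R}) a b :
  (forall c, a <= c <= b -> ~~ root p c) ->
  a <= b -> sgz p.[a] = sgz p.[b].
Proof.
move=> nr le_ab; rewrite -[LHS]sgz_sgr -[RHS]sgz_sgr; congr sgz.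
apply: (@polyrN0_itv R `[a, b]%R); rewrite ?in_itv /= ?lexx ?le_ab //.
Qed.

Lemma poly_ivt_sgz (R : rcfType) (p : {poly R}) a b :
  a < b -> p.[a] != 0 -> p.[b] != 0 -> sgz p.[a] != sgz p.[b] ->
  exists2 c, a < c < b & root p c.
Proof.
move=> lt_ab pa pb sab; have [|c] := @poly_ivtoo R p a b (ltW lt_ab).
  move: pa pb; rewrite -[p.[a] == 0]sgz_eq0 -[p.[b] == 0]sgz_eq0.
  rewrite -sgz_lt0 sgzM; move: sab.
  by do 2!case: sgzP.
by rewrite in_itv /=; exists c.
Qed.

Lemma poly_rolle_root (R : rcfType) (p : {poly R}) a b :
  a < b -> root p a -> root p b -> exists2 c, a < c < b & root p^`() c.
Proof.
move=> lt_ab /rootP pa /rootP pb; have [|c] := poly_rolle lt_ab (p := p).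
  by rewrite pa pb.
by rewrite in_itv /= => cab /rootP; exists c.
Qed.

Variables R1 R2 : rcfType.
Implicit Types Z : seq (R1 * R2).

Definition same_pos Z (y : R1) (y' : R2) :=
  forall z, z \in Z -> (y < z.1) = (y' < z.2) /\ (z.1 < y) = (z.2 < y').

(** Since all strict comparisons agree, [Z] is the graph of an order isomorphism between two finite
    sets, so it is in particular functional and injective. *)
Definition order_match Z := forall z, z \in Z -> same_pos Z z.1 z.2.

Lemma same_pos_sub Z Z' y y' :
  {subset Z <= Z'} -> same_pos Z' y y' -> same_pos Z y y'.
Proof. by move=> sZ pZ z /sZ /pZ. Qed.

Lemma same_pos_eq Z z y y' :
  same_pos Z y y' -> z \in Z -> (y == z.1) = (y' == z.2).
Proof.
by move=> pZ /pZ[e1 e2]; rewrite !eq_le !leNgt e1 e2.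
Qed.

Lemma exists_neighbours Z y a0 b0 :
  a0 \in Z -> b0 \in Z -> a0.1 < y < b0.1 -> y \notin map fst Z ->
  exists a b, [/\ a \in Z, b \in Z, a.1 < y < b.1 &
    forall z, z \in Z -> (z.1 <= a.1) || (b.1 <= z.1)].
Proof.
move=> a0Z b0Z /andP[a0y yb0] yZ.
have [|a [aZ ay maxa]] := @seq_argmax _ _ R1 fst (fun z => z.1 < y) Z.
  by apply/hasP; exists a0.
have [|b [bZ yb minb]] := @seq_argmax _ _ R1 (fun z => - z.1) (fun z => y < z.1) Z.
  by apply/hasP; exists b0.
exists a, b; split=> //; first by rewrite ay yb.
move=> z zZ; case: (ltgtP z.1 y) => [/(maxa z zZ) ->//|/(minb z zZ)|zy].
  by rewrite lerN2 orbC => ->.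
by case/negP: yZ; rewrite -zy map_f.
Qed.

(** The gap between [a] and [b] is assumed in [R1] only; the order isomorphism carries it to
    [R2]. *)
Lemma same_pos_between Z a b y y' :
  order_match Z -> a \in Z -> b \in Z ->
  (forall z, z \in Z -> (z.1 <= a.1) || (b.1 <= z.1)) ->
  a.1 < y < b.1 -> a.2 < y' < b.2 -> same_pos Z y y'.
Proof.
move=> mZ aZ bZ gap /andP[ay yb] /andP[ay' yb'] z zZ.
have [_ az] := mZ _ zZ _ aZ; have [zb _] := mZ _ zZ _ bZ.
case/orP: (gap z zZ) => le_z.
  have le_z' : z.2 <= a.2 by rewrite leNgt -az -leNgt.
  rewrite (le_lt_trans le_z ay) (le_lt_trans le_z' ay'); split=> //.
  by rewrite !ltNge (ltW (le_lt_trans le_z ay)) (ltW (le_lt_trans le_z' ay')).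
have le_z' : b.2 <= z.2 by rewrite leNgt -zb -leNgt.
rewrite (lt_le_trans yb le_z) (lt_le_trans yb' le_z'); split=> //.
by rewrite !ltNge (ltW (lt_le_trans yb le_z)) (ltW (lt_le_trans yb' le_z')).
Qed.

(* The two sentinels play the role of -oo and +oo. *)
Definition bracket Z m m' := (- m, - m') :: (m, m') :: Z.

Lemma bracket_sub Z m m' : {subset Z <= bracket Z m m'}.
Proof. by move=> z zZ; rewrite !inE zZ !orbT. Qed.

Lemma order_match_bracket Z m m' : order_match Z -> 0 < m -> 0 < m' ->
  (forall z, z \in Z -> - m < z.1 < m) ->
  (forall z, z \in Z -> - m' < z.2 < m') -> order_match (bracket Z m m').
Proof.
move=> mZ m0 m0' Zm Zm'.
have mm : - m < m by rewrite gt0_cp.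
have mm' : - m' < m' by rewrite gt0_cp.
move=> z; rewrite !inE => /or3P[/eqP->|/eqP->|zZ] w;
  rewrite !inE => /or3P[/eqP->|/eqP->|wZ] /=;
  try (have /andP[z1 z2] := Zm _ zZ; have /andP[z3 z4] := Zm' _ zZ);
  try (have /andP[w1 w2] := Zm _ wZ; have /andP[w3 w4] := Zm' _ wZ);
  rewrite ?ltxx ?mm ?mm' ?z1 ?z2 ?z3 ?z4 ?w1 ?w2 ?w3 ?w4 //;
  try (exact: mZ); by split=> //; apply/idP/idP => /ltW; rewrite leNgt ?mm ?mm'
    ?z1 ?z2 ?z3 ?z4 ?w1 ?w2 ?w3 ?w4.
Qed.

Lemma seq_bound (R : realDomainType) (s : seq R) :
  exists2 m, 0 < m & forall u, u \in s -> - m < u < m.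
Proof.
elim: s => [|x s [m m0 bm]]; first by exists 1.
have lt1 : m < m + `|x| + 1 by rewrite ltr_pwDr // lerDl.
have lt2 : `|x| < m + `|x| + 1 by rewrite ltr_pwDr // lerDr ltW.
exists (m + `|x| + 1); first exact: lt_trans m0 lt1.
move=> u; rewrite inE => /predU1P[->|/bm /andP[mu um]].
  by rewrite -ltr_norml.
by rewrite (lt_trans um lt1) andbT (lt_trans _ mu) // ltrN2.
Qed.

(** The extension step of a back-and-forth argument: a new point falls into a gap of [Z], possibly
    an unbounded one closed off by a sentinel, and the midpoint of the corresponding gap is in the
    same position. *)
Lemma order_match_back_forth Z y :
  order_match Z -> exists y', same_pos Z y y'.
Proof.
move=> mZ; have [|yZ] := boolP (y \in map fst Z).
  by case/mapP=> z zZ ->; exists z.2; apply: mZ.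
have [m m0 bm] := seq_bound (y :: map fst Z).
have [m' m0' bm'] := seq_bound (map snd Z).
have mZx : order_match (bracket Z m m').
  apply: order_match_bracket => // z zZ; last by apply: bm'; apply: map_f.
  by apply: bm; rewrite inE map_f ?orbT.
have /andP[my ym] := bm y (mem_head _ _).
have [||||a [b [aZ bZ ayb gap]]] :=
    @exists_neighbours (bracket Z m m') y (- m, - m') (m, m').
- by rewrite mem_head.
- by rewrite !inE eqxx orbT.
- by rewrite /= my ym.
- by rewrite !inE !negb_or yZ gt_eqF // lt_eqF.
have lt_ab' : a.2 < b.2.
  have [<- _] := mZx a aZ b bZ; case/andP: ayb; exact: lt_trans.
exists ((a.2 + b.2) / 2%:R).
apply: (same_pos_sub (@bracket_sub Z m m')).
by apply: (same_pos_between mZx aZ bZ); rewrite ?midf_lt.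
Qed.

Lemma order_match_between Z y y' m m' (p : {poly R1}) (q : {poly R2}) :
  order_match Z -> same_pos Z y y' -> y \notin map fst Z ->
  (forall u, u \in [:: y, cauchy_bound p & map fst Z] -> - m < u < m) ->
  (forall u, u \in [:: y', cauchy_bound q & map snd Z] -> - m' < u < m') ->
  0 < m -> 0 < m' ->
  exists a b, [/\ order_match (bracket Z m m'),
    a \in bracket Z m m' /\ b \in bracket Z m m',
    a.1 < y < b.1, a.2 < y' < b.2 &
    forall z, z \in bracket Z m m' -> (z.1 <= a.1) || (b.1 <= z.1)].
Proof.
move=> mZ pyy yZ bm bm' m0 m0'.
have mZx : order_match (bracket Z m m').
  apply: order_match_bracket => // z zZ.
    by apply: bm; rewrite !inE map_f ?orbT.
  by apply: bm'; rewrite !inE map_f ?orbT.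
have /andP[my ym] := bm y (mem_head _ _).
have /andP[my' ym'] := bm' y' (mem_head _ _).
have [||||a [b [aZ bZ ayb gap]]] :=
    @exists_neighbours (bracket Z m m') y (- m, - m') (m, m').
- by rewrite !inE eqxx ?orbT.
- by rewrite !inE eqxx ?orbT.
- by rewrite /= my ym.
- by rewrite !inE !negb_or yZ gt_eqF // lt_eqF.
exists a, b; split=> //.
have pyx : same_pos (bracket Z m m') y y'.
  move=> z; rewrite !inE => /or3P[/eqP->|/eqP->|/pyy //] /=.
    by rewrite my my' !ltNge (ltW my) (ltW my').
  by rewrite ym ym' !ltNge (ltW ym) (ltW ym').
by have [_ <-] := pyx a aZ; have [<- _] := pyx b bZ.
Qed.

End PartialIsomorphism.

(** * Matching the roots and signs of one more polynomial *)

Section OneMorePolynomial.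
Variables R1 R2 : rcfType.
Implicit Types Z : seq (R1 * R2).

Lemma mem_second (T : eqType) (x y : T) s : y \in [:: x, y & s].
Proof. by rewrite !inE eqxx orbT. Qed.

Lemma sgz_cauchy (R : rcfType) (p : {poly R}) m : p != 0 -> cauchy_bound p < m ->
  sgz p.[m] = sgz (lead_coef p) /\
  sgz p.[- m] = sgz ((-1) ^+ (size p).-1 * lead_coef p).
Proof.
move=> p0 lt_m; split; rewrite -[LHS]sgz_sgr -[RHS]sgz_sgr; congr sgz.
  apply: (@sgp_pinftyP R (cauchy_bound p)); first exact: ge_cauchy_bound.
  by rewrite in_itv /= ltW.
apply: (@sgp_minftyP R (- cauchy_bound p)); first exact: le_cauchy_bound.
by rewrite in_itv /= lerN2 ltW.
Qed.

(** What is known about [g] and [h] before their own roots are matched. The size and the leading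
    sign fix the signs at both infinities, and [Z] will contain the roots of the derivatives. *)
Definition compatible Z (g : {poly R1}) (h : {poly R2}) :=
  [/\ size g = size h, sgz (lead_coef g) = sgz (lead_coef h) &
    forall z, z \in Z -> sgz g.[z.1] = sgz h.[z.2]].

(** Beyond the Cauchy bounds the sign depends only on the leading coefficient and the parity of the
    degree. *)
Lemma compatible_bracket Z g h m m' : compatible Z g h -> g != 0 ->
  cauchy_bound g < m -> cauchy_bound h < m' -> compatible (bracket Z m m') g h.
Proof.
move=> [sgh lgh Zgh] g0 gm hm'; split=> // z.
have h0 : h != 0 by rewrite -size_poly_eq0 -sgh size_poly_eq0.
have [g1 g2] := sgz_cauchy g0 gm; have [h1 h2] := sgz_cauchy h0 hm'.
rewrite !inE => /or3P[/eqP->|/eqP->|/Zgh//] /=; last by rewrite g1 h1.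
by rewrite g2 h2 !sgzM lgh sgh !sgzX !sgzN !sgz1.
Qed.

(** The gap of [Z] around [y] contains no root of the derivative of [g], so [g] is strictly monotone
    there and changes sign at [y]. The ends of the matching gap show the same signs of [h], and the
    intermediate value theorem gives [w]. *)
Lemma matched_root Z g h y : order_match Z -> compatible Z g h -> g != 0 ->
  (forall c, root g^`() c -> c \in map fst Z) ->
  root g y -> y \notin map fst Z ->
  exists2 w, same_pos Z y w & root h w.
Proof.
move=> mZ cZ g0 Zg' gy yZ.
have [y' pyy] := order_match_back_forth y mZ.
have [m m0 bm] := seq_bound [:: y, cauchy_bound g & map fst Z].
have [m' m0' bm'] := seq_bound [:: y', cauchy_bound h & map snd Z].
have [a [b [mZx [aZ bZ] /andP[ay yb] ayb' gap]]] :=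
  order_match_between mZ pyy yZ bm bm' m0 m0'.
have [||_ _ Zgh] := compatible_bracket cZ g0 (m := m) (m' := m').
- by case/andP: (bm _ (mem_second _ _ _)).
- by case/andP: (bm' _ (mem_second _ _ _)).
have g'N c : a.1 < c < b.1 -> ~~ root g^`() c.
  move=> /andP[ac cb]; apply/negP => /Zg' /mapP[z zZ Ec].
  have := gap z (bracket_sub m m' zZ); rewrite -Ec.
  by rewrite leNgt ac leNgt cb.
have ga : g.[a.1] != 0.
  apply/negP => /(poly_rolle_root ay) /(_ gy)[c /andP[ac cy]].
  by apply/negP; rewrite g'N // ac (lt_trans cy yb).
have gb : g.[b.1] != 0.
  apply/negP => /(poly_rolle_root yb gy)[c /andP[yc cb]].
  by apply/negP; rewrite g'N // cb (lt_trans ay yc).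
(* With equal signs at both ends, the mean value theorem would give the derivative opposite signs on
   the two sides of [y], hence a root inside the gap. *)
have sab : sgz g.[a.1] != sgz g.[b.1].
  have [c1 c1P E1] := poly_mvt g ay; have [c2 c2P E2] := poly_mvt g yb.
  move: c1P c2P; rewrite !in_itv /= => /andP[ac1 c1y] /andP[yc2 c2b].
  apply/eqP => sab; move: E1 E2; rewrite (rootP gy) sub0r subr0 => E1 E2.
  have lt12 := lt_trans c1y yc2.
  have [|||c /andP[c1c cc2]] := poly_ivt_sgz lt12 (p := g^`()).
  - by apply: contraNneq ga => c10; rewrite -oppr_eq0 E1 c10 mul0r.
  - by apply: contraNneq gb => c20; rewrite E2 c20 mul0r.
  - move/(congr1 (@sgz R1)): E2; move/(congr1 (@sgz R1)): E1.
    rewrite !sgzM sgzN [sgz (y - _)]gtr0_sgz ?[sgz (_ - y)]gtr0_sgz ?subr_gt0 //.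
    rewrite !mulr1 => <- <-.
    by rewrite -sab eqNr sgz_eq0.
  by apply/negP; rewrite g'N // (lt_trans ac1 c1c) (lt_trans cc2 c2b).
have lt_ab' : a.2 < b.2 by case/andP: ayb'; apply: lt_trans.
have [|||w awb hw] := poly_ivt_sgz lt_ab' (p := h).
- by rewrite -sgz_eq0 -Zgh // sgz_eq0.
- by rewrite -sgz_eq0 -Zgh // sgz_eq0.
- by rewrite -!Zgh.
exists w => //; apply: (same_pos_sub (@bracket_sub _ _ Z m m')).
by apply: (same_pos_between mZx aZ bZ); rewrite ?ay.
Qed.

(** Neither polynomial has a root inside the matching gaps, so its sign there is its sign at any end
    of the gap that is not a root, and at the ends the signs agree. *)
Lemma compatible_sgz Z g h y y' : order_match Z -> compatible Z g h -> g != 0 ->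
  (forall c, root g^`() c -> c \in map fst Z) ->
  (forall c, root g c -> c \in map fst Z) ->
  (forall c, root h c -> c \in map snd Z) ->
  same_pos Z y y' -> sgz g.[y] = sgz h.[y'].
Proof.
move=> mZ cZ g0 Zg' Zg Zh pyy; have [|yZ] := boolP (y \in map fst Z).
  case/mapP=> z zZ yz; have := same_pos_eq pyy zZ.
  by rewrite yz eqxx => /esym/eqP->; case: cZ => _ _ ->.
have [m m0 bm] := seq_bound [:: y, cauchy_bound g & map fst Z].
have [m' m0' bm'] := seq_bound [:: y', cauchy_bound h & map snd Z].
have [a [b [mZx [aZ bZ] /andP[ay yb] /andP[ay' yb'] gap]]] :=
  order_match_between mZ pyy yZ bm bm' m0 m0'.
have [||_ _ Zgh] := compatible_bracket cZ g0 (m := m) (m' := m').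
- by case/andP: (bm _ (mem_second _ _ _)).
- by case/andP: (bm' _ (mem_second _ _ _)).
have domN c : a.1 < c < b.1 -> c \notin map fst Z.
  move=> /andP[ac cb]; apply/negP => /mapP[z zZ Ec].
  have := gap z (bracket_sub m m' zZ); rewrite -Ec.
  by rewrite leNgt ac leNgt cb.
have codN c : a.2 < c < b.2 -> c \notin map snd Z.
  move=> /andP[ac cb]; apply/negP => /mapP[z zZ Ec].
  have zZx := bracket_sub m m' zZ.
  have := gap z zZx; have [_ ] := mZx _ zZx _ aZ; have [] := mZx _ zZx _ bZ.
  by rewrite leNgt leNgt -Ec ac cb => -> _ ->.
have gN c : a.1 < c < b.1 -> ~~ root g c by move=> /domN; apply: contra => /Zg.
have hN c : a.2 < c < b.2 -> ~~ root h c by move=> /codN; apply: contra => /Zh.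
(* By Rolle the two ends are not both roots of [g]; if the left one is a root, the sign is read at
   the right one. *)
have [ga|ga] := boolP (root g a.1).
  have gb : ~~ root g b.1.
    apply/negP => /(poly_rolle_root (lt_trans ay yb) ga)[c /domN].
    by move=> /negP cN /Zg'.
  have hb : ~~ root h b.2 by rewrite /root -sgz_eq0 -Zgh // sgz_eq0.
  rewrite (@sgz_noroot _ g y b.1) ?(ltW yb) //; last first.
    move=> c /andP[yc]; rewrite le_eqVlt => /predU1P[->//|cb].
    by apply: gN; rewrite cb (lt_le_trans ay yc).
  rewrite (@sgz_noroot _ h y' b.2) ?(ltW yb') ?Zgh //.
  move=> c /andP[yc]; rewrite le_eqVlt => /predU1P[->//|cb].
  by apply: hN; rewrite cb (lt_le_trans ay' yc).
have ha : ~~ root h a.2 by rewrite /root -sgz_eq0 -Zgh // sgz_eq0.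
rewrite -(@sgz_noroot _ g a.1 y) ?(ltW ay) //; last first.
  move=> c /andP[]; rewrite le_eqVlt => /predU1P[<-//|ac cy].
  by apply: gN; rewrite ac (le_lt_trans cy yb).
rewrite -(@sgz_noroot _ h a.2 y') ?(ltW ay') ?Zgh //.
move=> c /andP[]; rewrite le_eqVlt => /predU1P[<-//|ac cy].
by apply: hN; rewrite ac (le_lt_trans cy yb').
Qed.

End OneMorePolynomial.

Section SwapPairs.
Variables R1 R2 : rcfType.
Implicit Types Z : seq (R1 * R2).

Definition swap_pairs Z := [seq (z.2, z.1) | z <- Z].

Lemma mem_swap Z x y : ((y, x) \in swap_pairs Z) = ((x, y) \in Z).
Proof.
by apply/mapP/idP => [[[a b] abZ [-> ->]]//|xyZ]; exists (x, y).
Qed.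

Lemma same_pos_swap Z y y' : same_pos (swap_pairs Z) y' y <-> same_pos Z y y'.
Proof.
split=> pZ [a b] abZ; last by move: abZ; rewrite mem_swap => /pZ [].
by have := pZ (b, a); rewrite mem_swap => /(_ abZ) [].
Qed.

Lemma map_fst_swap Z : map fst (swap_pairs Z) = map snd Z.
Proof. by rewrite -map_comp. Qed.

Lemma order_match_swap Z : order_match Z -> order_match (swap_pairs Z).
Proof. by move=> mZ [b a]; rewrite mem_swap => /mZ /same_pos_swap. Qed.

Lemma compatible_swap Z g h : compatible Z g h -> compatible (swap_pairs Z) h g.
Proof.
case=> sgh lgh Zgh; split=> // -[b a]; rewrite mem_swap => /Zgh /= ->.
by [].
Qed.

End SwapPairs.

Section ExtendMatch.
Variables R1 R2 : rcfType.
Implicit Types Z : seq (R1 * R2).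

(** The zero polynomial is exempt because no finite list contains all of its roots. *)
Definition covers (R : rcfType) (s : seq R) (p : {poly R}) :=
  p != 0 -> forall c, root p c -> c \in s.

Lemma compatible_eq0 Z (g : {poly R1}) (h : {poly R2}) :
  compatible Z g h -> (g == 0) = (h == 0).
Proof. by case=> sgh _ _; rewrite -!size_poly_eq0 sgh. Qed.

Lemma compatible_const Z (g : {poly R1}) (h : {poly R2}) y y' :
  compatible Z g h -> (size g <= 1)%N -> sgz g.[y] = sgz h.[y'].
Proof.
case=> sgh lgh _ sg1; move: (sg1) lgh; rewrite {1}sgh => sh1.
by rewrite (size1_polyC sg1) (size1_polyC sh1) !lead_coefC !hornerC.
Qed.

(** Each root of [g] missing from [Z] is paired with a root of [h] in the same gap. Rolle makes the
    pairing increasing, and the symmetric argument on swapped pairs shows that it exhausts the roots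
    of [h]. *)
Lemma extend_match Z (g : {poly R1}) (h : {poly R2}) :
  order_match Z -> compatible Z g h ->
  covers (map fst Z) g^`() -> covers (map snd Z) h^`() ->
  exists Z', [/\ order_match Z', {subset Z <= Z'},
    forall z, z \in Z' -> z \in Z \/ g != 0 /\ root g z.1,
    covers (map fst Z') g /\ covers (map snd Z') h &
    forall y y', same_pos Z' y y' -> sgz g.[y] = sgz h.[y']].
Proof.
move=> mZ cZ Zg' Zh'; have [sgh _ Zgh] := cZ.
have deriv_neq0 (R : rcfType) (p : {poly R}) : (size p > 1)%N -> p^`() != 0.
  by move=> sp; rewrite -size_poly_eq0 size_deriv -lt0n; case: size sp => [|[]].
have [sg1|sg1] := leqP (size g) 1.
  have nor (R : rcfType) (p : {poly R}) s : (size p <= 1)%N -> covers s p.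
    move=> /size1_polyC->; rewrite /covers polyC_eq0 => p0 c.
    by rewrite rootC (negPf p0).
  exists Z; split=> //; first by left.
    by split; apply: nor; rewrite -?sgh.
  by move=> y y' _; apply: compatible_const cZ sg1.
have sh1 : (1 < size h)%N by rewrite -sgh.
have g0 : g != 0 by rewrite -size_poly_gt0 (ltn_trans _ sg1).
have h0 : h != 0 by rewrite -(compatible_eq0 cZ).
have {}Zg' := Zg' (deriv_neq0 _ _ sg1).
have {}Zh' := Zh' (deriv_neq0 _ _ sh1).
have /choice[f fP] : forall y, exists w, root g y -> y \notin map fst Z ->
    same_pos Z y w /\ root h w.
  move=> y.
  have [gy|gy] := boolP (root g y); last by exists 0.
  have [yZ|yZ] := boolP (y \in map fst Z); first by exists 0.
  by have [w] := matched_root mZ cZ g0 Zg' gy yZ; exists w.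
pose rs := [seq y <- roots g (- cauchy_bound g) (cauchy_bound g) |
             y \notin map fst Z].
have rsP y : y \in rs = root g y && (y \notin map fst Z).
  rewrite mem_filter andbC; congr (_ && _); apply/idP/idP; first exact: root_roots.
  by move=> gy; apply: root_in_roots => //; apply: root_in_cauchy_bound.
pose Z' := Z ++ [seq (y, f y) | y <- rs].
have Z'P z : z \in Z' -> z \in Z \/ z.1 \in rs /\ z.2 = f z.1.
  by rewrite mem_cat => /orP[|/mapP[y ys ->]]; [left|right].
(* A root of the derivative lies between [y1] and [y2]; its partner in [Z] separates the images. *)
have fmono y1 y2 : y1 \in rs -> y2 \in rs -> y1 < y2 -> f y1 < f y2.
  rewrite !rsP => /andP[gy1 y1Z] /andP[gy2 y2Z] lt12.
  have [c /andP[y1c cy2] /Zg' /mapP[z zZ Ec]] := poly_rolle_root lt12 gy1 gy2.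
  have [/(_ z zZ) [e1 _] _] := fP _ gy1 y1Z.
  have [/(_ z zZ) [_ e2] _] := fP _ gy2 y2Z.
  by rewrite (@lt_trans _ _ z.2) // -?e1 -?e2 -Ec.
have mZ' : order_match Z'.
  move=> z /Z'P[zZ|[zs Ez]] w /Z'P[wZ|[ws Ew]]; first exact: mZ.
  - move: ws; rewrite rsP Ew => /andP[gw wNZ].
    by have [/(_ z zZ)[-> ->] _] := fP _ gw wNZ.
  - move: zs; rewrite rsP Ez => /andP[gz zNZ].
    by have [/(_ w wZ)[-> ->] _] := fP _ gz zNZ.
  rewrite Ez Ew; case: (ltgtP z.1 w.1) => [lt_zw|lt_wz|->]; last by rewrite ltxx.
    by have lt_f := fmono _ _ zs ws lt_zw; rewrite lt_f ltNge ltW.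
  by have lt_f := fmono _ _ ws zs lt_wz; rewrite lt_f ltNge ltW.
have sZ : {subset Z <= Z'} by move=> z zZ; rewrite mem_cat zZ.
have sub1 c : c \in map fst Z -> c \in map fst Z'.
  by case/mapP=> z /sZ zZ' ->; apply: map_f.
have cg c : root g c -> c \in map fst Z'.
  move=> gc; have [/sub1//|cZN] := boolP (c \in map fst Z).
  apply/mapP; exists (c, f c) => //; rewrite mem_cat; apply/orP; right.
  by apply: map_f; rewrite rsP gc.
have ch c : root h c -> c \in map snd Z'.
  move=> hc; have [/mapP[z /sZ zZ' ->]|cZN] := boolP (c \in map snd Z).
    exact: map_f.
  have [||y] := matched_root (order_match_swap mZ) (compatible_swap cZ) h0 _ hc.
  - by rewrite map_fst_swap.
  - by rewrite map_fst_swap.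
  move=> /same_pos_swap pyc gy.
  have yZN : y \notin map fst Z.
    apply: contra cZN => /mapP[z zZ Ez].
    have := same_pos_eq pyc zZ; rewrite Ez eqxx => /esym/eqP->.
    exact: map_f.
  have [pyf hf] := fP _ gy yZN.
  (* Both are roots of [h] in the same gap; if they differed, a root of the derivative of [h], hence
     a point of [Z], would separate them. *)
  suff -> : c = f y.
    by apply/mapP; exists (y, f y); rewrite // mem_cat map_f ?orbT // rsP gy.
  case: (ltgtP c (f y)) => // lt_cf.
    have [d /andP[cd df] /Zh' /mapP[z zZ Ed]] := poly_rolle_root lt_cf hc hf.
    have [[e1 _] [e2 _]] := (pyc _ zZ, pyf _ zZ).
    by move: e2; rewrite e1 -Ed cd ltNge (ltW df).
  have [d /andP[cd df] /Zh' /mapP[z zZ Ed]] := poly_rolle_root lt_cf hf hc.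
  have [[e1 _] [e2 _]] := (pyc _ zZ, pyf _ zZ).
  by move: e2; rewrite e1 -Ed cd ltNge (ltW df).
exists Z'; split=> //.
  move=> z /Z'P[|[]]; first by left.
  by rewrite rsP => /andP[gz _]; right.
  by split=> _ c; [apply: cg | apply: ch].
move=> y y'; apply: compatible_sgz => //; last by move=> c /Zg' /sub1.
split=> //; first by case: cZ.
move=> z /Z'P[/Zgh//|[]]; rewrite rsP => /andP[gz zNZ] ->.
by have [_ /rootP->] := fP _ gz zNZ; rewrite (rootP gz) !sgz0.
Qed.

End ExtendMatch.

(** * Elimination of one variable *)

Section CohenHormanderClosure.
Variable B : comNzRingType.
Implicit Types (p q : {poly B}) (G : seq {poly B}).
Import Pdiv.Ring.

(* The extra power of the leading coefficient makes the multiplier of p in    *)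
(* the pseudo-division a square, so that signs are preserved.                 *)
Definition signed_rem p q := lead_coef q ^+ rscalp p q *: rmodp p q.

Lemma signed_remP p q :
  (lead_coef q ^+ rscalp p q) ^+ 2 *: p =
  lead_coef q ^+ rscalp p q *: rdivp p q * q + signed_rem p q.
Proof.
by rewrite expr2 -scalerA Pdiv.ComRing.rdivp_eq scalerDr scalerAl.
Qed.

Lemma size_signed_rem p q : q != 0 -> (size (signed_rem p q) < size q)%N.
Proof. by move=> q0; rewrite (leq_ltn_trans (size_scale_leq _ _)) ?ltn_rmodp. Qed.

(** Truncations are included because a morphism may kill leading coefficients; the image of [p] is
    then the image of a truncation whose leading coefficient survives. *)
Definition closed_above k G :=
  [/\ forall p, p \in G -> (k < size p)%N -> p^`() \in G,
      forall p i, p \in G -> (k < size p)%N -> (i < size p)%N ->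
        take_poly i p \in G &
      forall p q, p \in G -> q \in G -> (k < size q <= size p)%N ->
        signed_rem p q \in G].

(** Each operation on a member of size k+1, including reduction modulo it, produces a polynomial of
    size at most k. Adding these results therefore creates no new obligation above size k. *)
Lemma closed_above0_exists k G : closed_above k G ->
  exists2 G', {subset G <= G'} & closed_above 0 G'.
Proof.
elim: k G => [|k IHk] G cG; first by exists G.
pose ops p := p^`() :: [seq take_poly i p | i <- iota 0 (size p)].
pose Gk := [seq p : {poly B} <- G | size p == k.+1].
pose G1 := flatten (map ops Gk) ++ [seq signed_rem p q | p <- G, q <- Gk].
have G1size p : p \in G1 -> (size p <= k)%N.
  rewrite mem_cat => /orP[/flattenP[s /mapP[q]]|/allpairsP[[q r] /=]].
    rewrite mem_filter => /andP[/eqP sq qG] -> {s}.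
    rewrite inE => /predU1P[->|/mapP[i]].
      by rewrite -ltnS -sq lt_size_deriv // -size_poly_gt0 sq.
    rewrite mem_iota sq /= add0n ltnS => le_ik ->.
    exact: leq_trans (size_take_poly _ _) le_ik.
  rewrite mem_filter => -[qG /andP[/eqP sr rG] ->].
  by rewrite -ltnS -sr size_signed_rem // -size_poly_gt0 sr.
have GE p : p \in G ++ G1 -> (k < size p)%N -> p \in G.
  by rewrite mem_cat => /orP[//|/G1size]; rewrite leqNgt => /negPf->.
have [cd ct cr] := cG.
have [|G' sG cG'] := IHk (G ++ G1).
  split.
  - move=> p pG lt_k; rewrite mem_cat; have {}pG := GE p pG lt_k.
    move: lt_k; rewrite leq_eqVlt => /predU1P[sp|/(cd p pG)->//].
    apply/orP; right; rewrite mem_cat; apply/orP; left.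
    apply/flattenP; exists (ops p); last exact: mem_head.
    by apply: map_f; rewrite mem_filter -sp eqxx.
  - move=> p i pG lt_k lt_i; rewrite mem_cat; have {}pG := GE p pG lt_k.
    move: lt_k; rewrite leq_eqVlt => /predU1P[sp|lt_k]; last by rewrite ct.
    apply/orP; right; rewrite mem_cat; apply/orP; left.
    apply/flattenP; exists (ops p); first by apply: map_f; rewrite mem_filter -sp eqxx.
    by rewrite inE; apply/orP; right; apply: map_f; rewrite mem_iota.
  move=> p q pG qG /andP[lt_k le_qp]; rewrite mem_cat.
  have {}qG := GE q qG lt_k; have {}pG := GE p pG (leq_trans lt_k le_qp).
  move: lt_k; rewrite leq_eqVlt => /predU1P[sq|lt_k]; last by rewrite cr ?lt_k.
  apply/orP; right; rewrite mem_cat; apply/orP; right.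
  by apply: allpairs_f; rewrite // mem_filter -sq eqxx.
by exists G' => // p pG; apply: sG; rewrite mem_cat pG.
Qed.

Lemma closed_exists G : exists2 G', {subset G <= G'} & closed_above 0 G'.
Proof.
apply: (@closed_above0_exists (\max_(p <- G) size p)%N).
have leG p : p \in G -> ((\max_(p <- G) size p)%N < size p)%N = false.
  by move=> pG; rewrite ltnNge (leq_bigmax_seq (F := fun p => size p)).
split=> [p /leG->//|p i /leG->//|p q _ /leG->//].
Qed.
End CohenHormanderClosure.

Lemma size_lead_coef_sgz (R1 R2 : realDomainType) (p : {poly R1}) (q : {poly R2}) :
  (forall i, sgz p`_i = sgz q`_i) ->
  size p = size q /\ sgz (lead_coef p) = sgz (lead_coef q).
Proof.
move=> pq; suff s : size p = size q by rewrite /lead_coef s pq.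
apply/eqP; rewrite eqn_leq; apply/andP; split; apply/leq_sizeP => j le_j.
  by apply/eqP; rewrite -sgz_eq0 pq sgz_eq0 nth_default.
by apply/eqP; rewrite -sgz_eq0 -pq sgz_eq0 nth_default.
Qed.

Lemma map_take_poly_size (B R : nzRingType) (f : {rmorphism B -> R})
    (p : {poly B}) k : (size (map_poly f p) <= k)%N ->
  map_poly f (take_poly k p) = map_poly f p.
Proof.
move=> le_k; apply/polyP => i; rewrite !coef_map /= coef_take_poly.
case: ltnP => // le_ki; rewrite rmorph0 -coef_map nth_default //.
exact: leq_trans le_k le_ki.
Qed.

(** * Matching all roots of a closed family *)

Section Sweep.
Variables (B : comNzRingType) (G : seq {poly B}) (R1 R2 : rcfType).
Variables (f1 : {rmorphism B -> R1}) (f2 : {rmorphism B -> R2}).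
Hypothesis cG : closed_above 0 G.
Hypothesis fG : forall p, p \in G -> forall i, sgz (f1 p`_i) = sgz (f2 p`_i).
Local Notation m1 := (map_poly f1).
Local Notation m2 := (map_poly f2).

(** The second clause makes every matched point a root of a treated polynomial, so that
    [sgz_at_root] can reduce modulo that polynomial. *)
Definition swept (l : seq {poly B}) (Z : seq (R1 * R2)) :=
  [/\ order_match Z,
    forall z, z \in Z -> exists2 p, p \in l & m1 p != 0 /\ root (m1 p) z.1 &
    forall p, p \in l -> [/\ covers (map fst Z) (m1 p),
      covers (map snd Z) (m2 p) &
      forall y y', same_pos Z y y' -> sgz (m1 p).[y] = sgz (m2 p).[y']]].

Lemma size_map_agree p : p \in G ->
  size (m1 p) = size (m2 p) /\ sgz (lead_coef (m1 p)) = sgz (lead_coef (m2 p)).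
Proof. by move=> pG; apply: size_lead_coef_sgz => i; rewrite !coef_map fG. Qed.

(** Let [p] be a treated polynomial vanishing at the point and [q] its truncation to the surviving
    leading term. At a root of [q], the sign of [g] is that of [signed_rem g q], which is smaller
    than [g] and therefore already treated. *)
Lemma sgz_at_root l Z g z : swept l Z -> {subset l <= G} -> g \in G ->
  (forall p, p \in l -> (size p <= size g)%N) ->
  (forall p, p \in G -> (size p < size g)%N -> p \in l) ->
  z \in Z -> sgz (m1 g).[z.1] = sgz (m2 g).[z.2].
Proof.
move=> [mZ rZ lZ] lG gG le_g lt_g zZ.
have [p pl [m1p0 rp1]] := rZ z zZ.
have pG := lG _ pl; have [sp _] := size_map_agree pG.
have rp2 : root (m2 p) z.2.
  have [_ _ /(_ _ _ (mZ _ zZ)) e] := lZ p pl.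
  by rewrite /root -sgz_eq0 -e sgz_eq0.
pose k := size (m1 p); have k0 : (0 < k)%N by rewrite size_poly_gt0.
have le_kp : (k <= size p)%N by apply: size_poly.
pose q := take_poly k p.
have qG : q \in G.
  move: le_kp; rewrite leq_eqVlt => /predU1P[kp|lt_kp].
    by rewrite /q kp take_poly_id.
  by have [_ ct _] := cG; apply: ct; rewrite // (leq_trans _ lt_kp).
have m1q : m1 q = m1 p by apply: map_take_poly_size.
have m2q : m2 q = m2 p by apply: map_take_poly_size; rewrite -sp.
have sq : size q = k.
  apply/eqP; rewrite eqn_leq size_take_poly.
  by rewrite /k -m1q size_poly.
have q0 : q != 0 by rewrite -size_poly_gt0 sq.
have lq1 : f1 (lead_coef q) != 0.
  rewrite /lead_coef sq -coef_map m1q -/k.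
  by rewrite -[_`_ _]/(lead_coef (m1 p)) lead_coef_eq0.
have lq2 : f2 (lead_coef q) != 0 by rewrite -sgz_eq0 -fG // sgz_eq0.
have le_qg : (size q <= size g)%N by rewrite sq (leq_trans le_kp) ?le_g.
have rG : signed_rem g q \in G.
  by have [_ _ cr] := cG; apply: cr; rewrite // sq k0 -sq.
have rl : signed_rem g q \in l.
  by apply: lt_g => //; apply: leq_trans (size_signed_rem _ _) le_qg.
have [_ _ /(_ _ _ (mZ _ zZ))] := lZ _ rl.
have key (R : rcfType) (f : {rmorphism B -> R}) y : f (lead_coef q) != 0 ->
    root (map_poly f q) y ->
    sgz (map_poly f (signed_rem g q)).[y] = sgz (map_poly f g).[y].
  move=> lq0 /rootP qy; have := congr1 (fun r => (map_poly f r).[y]) (signed_remP g q).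
  rewrite rmorphD rmorphM hornerD hornerM qy mulr0 add0r => <-.
  rewrite linearZ /= hornerZ sgzM rmorphXn /= gtr0_sgz ?mul1r //.
  by rewrite exprn_even_gt0 //= rmorphXn expf_neq0.
by rewrite !key ?m1q ?m2q.
Qed.

Definition le_size (p q : {poly B}) := (size p <= size q)%N.

(** Treating polynomials by increasing size ensures that the derivative of [g] and the remainders
    modulo smaller members come before [g]. *)
Lemma swept_all l2 l1 Z : {subset l1 ++ l2 <= G} -> {subset G <= l1 ++ l2} ->
  sorted le_size (l1 ++ l2) ->
  swept l1 Z -> exists Z', swept (l1 ++ l2) Z'.
Proof.
have tr : transitive le_size.
  by move=> ? ? ?; apply: leq_trans.
elim: l2 l1 Z => [|g l2 IHl] l1 Z; first by rewrite cats0; exists Z.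
move=> sG Gs so sw.
have gG : g \in G by apply: sG; rewrite mem_cat mem_head orbT.
have l1G : {subset l1 <= G} by move=> p pl; apply: sG; rewrite mem_cat pl.
have le_g p : p \in l1 -> (size p <= size g)%N.
  move=> pl; move: so; rewrite sorted_pairwise // pairwise_cat.
  by case/andP=> /allrelP/(_ p g pl (mem_head _ _)).
have lt_g p : p \in G -> (size p < size g)%N -> p \in l1.
  move=> /Gs; rewrite mem_cat inE => /orP[//|/predU1P[->|pl]].
    by rewrite ltnn.
  move: so; rewrite sorted_pairwise // pairwise_cat => /and3P[_ _] /=.
  by case/andP=> /allP/(_ p pl); rewrite /le_size ltnNge => ->.
have [mZ rZ lZ] := sw.
have [sg lg] := size_map_agree gG.
have [||||Z' [mZ' sZ rZ' [cg ch] gZ]] := @extend_match R1 R2 Z (m1 g) (m2 g).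
- exact: mZ.
- by split=> // z; apply: sgz_at_root sw l1G gG le_g lt_g.
- have [->|g0] := eqVneq g 0; first by rewrite rmorph0 deriv0 /covers eqxx.
  rewrite deriv_map; have [cd _ _] := cG.
  have [] // := lZ g^`(); apply: lt_g; last by rewrite lt_size_deriv.
  by rewrite cd // size_poly_gt0.
- have [->|g0] := eqVneq g 0; first by rewrite rmorph0 deriv0 /covers eqxx.
  rewrite deriv_map; have [cd _ _] := cG.
  have [] // := lZ g^`(); apply: lt_g; last by rewrite lt_size_deriv.
  by rewrite cd // size_poly_gt0.
rewrite -cat_rcons; apply: (IHl (rcons l1 g) Z'); rewrite ?cat_rcons //.
split=> //.
  move=> z /rZ'[/rZ[p pl rp]|rg].
    by exists p; rewrite // mem_rcons inE pl orbT.
  by exists g; rewrite // mem_rcons mem_head.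
move=> p; rewrite mem_rcons inE => /predU1P[->//|pl].
have [c1 c2 pZ] := lZ p pl; split.
- by move=> p0 c /(c1 p0) /mapP[z /sZ zZ ->]; apply: map_f.
- by move=> p0 c /(c2 p0) /mapP[z /sZ zZ ->]; apply: map_f.
by move=> y y' pyy; apply: pZ; apply: same_pos_sub pyy.
Qed.

Lemma sweep y : exists y', forall p, p \in G -> sgz (m1 p).[y] = sgz (m2 p).[y'].
Proof.
pose s := sort le_size G.
have [||||Z [mZ _ lZ]] := @swept_all s [::] [::].
- by move=> p; rewrite mem_sort.
- by move=> p; rewrite mem_sort.
- by apply: sort_sorted => p q; apply: leq_total.
- by [].
have [y' pyy] := order_match_back_forth y mZ.
by exists y' => p pG; have [|_ _ /(_ _ _ pyy)] := lZ p; first by rewrite mem_sort.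
Qed.
End Sweep.

(** [H] consists of the coefficients of a closed family containing [G]. It is chosen before the
    fields and the morphisms, which is what makes this an elimination of [y]. *)
Lemma transfer1 (B : comNzRingType) (G : seq {poly B}) : exists H : seq B,
  forall (R1 R2 : rcfType) (f1 : {rmorphism B -> R1}) (f2 : {rmorphism B -> R2}),
  (forall h, h \in H -> sgz (f1 h) = sgz (f2 h)) ->
  forall y, exists y', forall g, g \in G ->
    sgz (map_poly f1 g).[y] = sgz (map_poly f2 g).[y'].
Proof.
have [G' sG cG] := closed_exists G.
exists (flatten [seq polyseq p | p <- G']) => R1 R2 f1 f2 fH y.
have [|y' yy] := sweep cG (f1 := f1) (f2 := f2) _ y.
  move=> p pG i; have [le_pi|lt_ip] := leqP (size p) i.
    by rewrite nth_default // !rmorph0 !sgz0.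
  by apply: fH; apply/flattenP; exists (p : seq B); [apply: map_f | apply: mem_nth].
by exists y' => g /sG/yy.
Qed.

(** * Elimination of several variables *)

Section IteratedPolynomials.

(* Integer coefficients, with one variable for each constant of K that        *)
(* occurs, keep the ring countable, as countable_algebraic_closure requires.  *)
Fixpoint int_poly (n : nat) : countComNzRingType :=
  if n is k.+1 then {poly int_poly k} : countComNzRingType
  else int : countComNzRingType.

Fixpoint int_var n i : int_poly n :=
  if n is k.+1 then (if i == k then 'X else (int_var k i)%:P) : {poly int_poly k}
  else 0 : int.

Fixpoint int_eval (T : comNzRingType) (e : nat -> T) n : {rmorphism int_poly n -> T} :=
  match n return {rmorphism int_poly n -> T} with
  | 0%N => intmul 1 : {rmorphism int -> T}
  | k.+1 => (horner_eval (e k) \o map_poly (int_eval e k))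
              : {rmorphism {poly int_poly k} -> T}
  end.

Lemma int_evalS (T : comNzRingType) (e : nat -> T) n (p : {poly int_poly n}) :
  int_eval e n.+1 p = (map_poly (int_eval e n) p).[e n].
Proof. by []. Qed.

Lemma eq_int_eval (T : comNzRingType) (e e' : nat -> T) n :
  (forall i, (i < n)%N -> e i = e' i) -> int_eval e n =1 int_eval e' n.
Proof.
elim: n => [//|n IHn] ee p; rewrite !int_evalS ee //.
by rewrite (eq_map_poly (IHn _)) // => i lt_in; rewrite ee // leqW.
Qed.

Lemma rmorph_int_eval (T T' : comNzRingType) (f : {rmorphism T -> T'})
    (e : nat -> T) n p : f (int_eval e n p) = int_eval (f \o e) n p.
Proof.
elim: n p => [|n IHn] p; first exact: rmorph_int.
by rewrite !int_evalS -horner_map -map_poly_comp (eq_map_poly IHn).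
Qed.

Lemma rmorphism_int_eval (T : comNzRingType) n (f : {rmorphism int_poly n -> T}) p :
  f p = int_eval (f \o int_var n) n p.
Proof.
elim: n f p => [|n IHn] f p; first by rewrite -[p in LHS]intz rmorph_int.
rewrite int_evalS /= eqxx.
rewrite -[p in LHS]comp_polyXr /comp_poly -horner_map -map_poly_comp.
congr (_.[_]); apply: eq_map_poly => q /=.
have /= -> := IHn (f \o polyC) q; apply: eq_int_eval => i lt_in /=.
by rewrite ltn_eqF.
Qed.

Lemma int_eval_var (T : comNzRingType) (e : nat -> T) n i :
  (i < n)%N -> int_eval e n (int_var n i) = e i.
Proof.
elim: n => // n IHn; rewrite ltnS leq_eqVlt int_evalS /=.
have [-> _|ne_in /IHn <-] := eqVneq i n; first by rewrite map_polyX hornerX.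
by rewrite map_polyC hornerC.
Qed.

(** The outermost variable is eliminated first. Values are then found from the inside outwards,
    keeping the first [n] values of [e2]. *)
Lemma transfer n k (G : seq (int_poly (k + n))) : exists H : seq (int_poly n),
  forall (R1 R2 : rcfType) (e1 : nat -> R1) (e2 : nat -> R2),
  (forall h, h \in H -> sgz (int_eval e1 n h) = sgz (int_eval e2 n h)) ->
  exists2 e, forall i, (i < n)%N -> e i = e2 i &
    forall g, g \in G -> sgz (int_eval e1 (k + n) g) = sgz (int_eval e (k + n) g).
Proof.
elim: k G => [|k IHk] G; first by exists G => R1 R2 e1 e2 eH; exists e2.
have [H1 tr1] := @transfer1 (int_poly (k + n)) G; have [H trH] := IHk H1.
exists H => R1 R2 e1 e2 /trH[e ee2 /tr1/(_ (e1 (k + n)%N))[y yG]].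
exists (fun i => if i == (k + n)%N then y else e i) => [i lt_in|g /yG].
  by rewrite ltn_eqF ?ee2 // (leq_trans lt_in) ?leq_addl.
rewrite !int_evalS => ->; rewrite eqxx.
congr (sgz _.[_]); apply: eq_map_poly; apply: eq_int_eval => i lt_i.
by rewrite ltn_eqF.
Qed.
End IteratedPolynomials.

(** * Maximal cones of an algebraically closed field *)

Section WeightedSquares.
Variable F : realFieldType.
Implicit Types (p q h w : {poly F}) (s : seq (F * {poly F})).

Definition sum_sq s : {poly F} := \sum_(x <- s) x.1 *: x.2 ^+ 2.

Lemma sum_sq_horner_ge0 s a :
  (forall x, x \in s -> 0 <= x.1) -> 0 <= (sum_sq s).[a].
Proof.
move=> s0; rewrite /sum_sq horner_sum big_seq sumr_ge0 // => x /s0 x0.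
by rewrite hornerZ horner_exp mulr_ge0 // sqr_ge0.
Qed.

(* Descent: the cofactor of h in 1 + sum_sq s again changes sign between a    *)
(* and b, and has smaller degree once the terms of s are reduced modulo h.    *)
Lemma sign_change_ndvd h a b s : h.[a] * h.[b] < 0 ->
  (forall x, x \in s -> 0 <= x.1) -> ~~ (h %| 1 + sum_sq s).
Proof.
have [n] := ubnP (size h); elim: n h s => // n IHn h s; rewrite ltnS => le_hn hab s0.
have h0 : h != 0 by apply: contraTneq hab => ->; rewrite !horner0 mul0r ltxx.
have sh : (1 < size h)%N.
  rewrite ltnNge; apply: contraTN hab => /size1_polyC->.
  by rewrite !hornerC -leNgt -expr2 sqr_ge0.
pose t := [seq (x.1, x.2 %% h) | x <- s].
have t0 x : x \in t -> 0 <= x.1 by case/mapP=> y /s0 y0 ->.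
have -> : (h %| 1 + sum_sq s) = (h %| 1 + sum_sq t).
  rewrite -[1 + sum_sq s](addrNK (1 + sum_sq t)) dvdp_addr //.
  rewrite opprD addrACA subrr add0r /sum_sq big_map -sumrB.
  rewrite big_seq; apply: (big_ind (fun q => h %| q)) => [||x _]; first exact: dvdp0.
    exact: dvdp_add.
  rewrite -scalerBr -mul_polyC dvdp_mull // subr_sqr dvdp_mulr //.
  by rewrite {1}[x.2](divp_eq _ h) addrK dvdp_mull.
apply/negP => hd; pose q := (1 + sum_sq t) %/ h.
have qh : q * h = 1 + sum_sq t by rewrite divpK.
have qh_gt0 c : 0 < q.[c] * h.[c].
  rewrite -hornerM qh hornerD hornerE ltr_pwDl //.
  exact: sum_sq_horner_ge0.
have qab : q.[a] * q.[b] < 0.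
  rewrite -(nmulr_lgt0 _ hab) mulrACA.
  exact: mulr_gt0.
have q0 : q != 0 by apply: contraTneq qab => ->; rewrite !horner0 mul0r ltxx.
(* If s is the size of [h], the squares of remainders have size at most 2(s-1)-1 = 2s-3, so the
   cofactor of [h] has size at most s-2. *)
have size_t : (size (1 + sum_sq t)%R <= (size h).*2.-1.-2)%N.
  have le1 : (1 <= (size h).*2.-1.-2)%N by case: size sh => [|[|k]] //; rewrite doubleS.
  rewrite (leq_trans (size_polyD _ _)) // size_poly1 geq_max le1 /=.
  rewrite /sum_sq big_seq; apply: (big_ind (fun q => size q <= _)%N) => [||x].
  - by rewrite size_poly0.
  - by move=> p1 p2 s1 s2; rewrite (leq_trans (size_polyD _ _)) // geq_max s1.
  case/mapP=> y _ -> /=; rewrite (leq_trans (size_scale_leq _ _)) //.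
  have lt_yh : (size (y.2 %% h)%R < size h)%N by rewrite ltn_modp.
  rewrite expr2 (leq_trans (size_polyMleq _ _)) // addnn.
  have := leq_double (size (y.2 %% h)) (size h).-1.
  case: (size h) lt_yh => // k; rewrite ltnS doubleS /= => -> le2.
  by rewrite -subn1 -[k.*2.-1]subn1 leq_sub2r.
have sq : (size q < n)%N.
  apply: leq_trans le_hn; move: size_t; rewrite -qh size_mul //.
  case: (size h) sh => [|[|k]] // _; rewrite !addnS !doubleS /= ltnS -addnn.
  by rewrite leq_add2r => /leqW.
by have /negP[] := IHn q t sq qab t0; rewrite -qh dvdp_mulr.
Qed.

End WeightedSquares.

(** * The real closed field spanned by a maximal cone *)

Section Cones.
Variable L : closedFieldType.
Implicit Types P Q : set L.
Local Open Scope classical_set_scope.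

(** Only squares of differences of members are required: in an algebraically closed field -1 is a
    square too, so a cone cannot contain all squares. *)
Definition is_cone P := [/\ P 1,
  forall x y, P x -> P y -> P (x + y),
  forall x y, P x -> P y -> P (x * y),
  forall x y, P x -> P y -> P ((x - y) ^+ 2) &
  forall x, P x -> P (- x) -> x = 0].

Record max_cone := MaxCone {
  max_cone_set :> L -> Prop;
  max_coneP : is_cone max_cone_set;
  max_cone_max : forall Q, is_cone Q -> max_cone_set `<=` Q -> Q `<=` max_cone_set
}.

(** Zorn's lemma is applied to the sets whose union with [P] is a cone, so that the empty chain is
    covered as well. *)
Lemma max_cone_exists P : is_cone P -> exists M : max_cone, P `<=` M.
Proof.
move=> cP; pose C A := is_cone (A `|` P).
have C0 : C set0 by rewrite /C set0U.
have [|A [CA maxA]] := @Zorn_bigcup L C.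
  move=> F FC totF; set U := \bigcup_(X in F) X.
  have one x : (U `|` P) x -> exists2 A, F A \/ A = set0 & (A `|` P) x.
    case=> [[A FA Ax]|Px]; first by exists A; left.
    by exists set0; right.
  have two x y : (U `|` P) x -> (U `|` P) y ->
      exists A, [/\ F A \/ A = set0, (A `|` P) x & (A `|` P) y].
    move=> /one[A [FA|->] Ax] /one[B [FB|->] By].
    - have [AB|BA] := totF _ _ FA FB.
        by exists B; split=> //; [left | case: Ax => [/AB|]; [left|right]].
      by exists A; split=> //; [left | case: By => [/BA|]; [left|right]].
    - by exists A; split=> //; [left | case: By => // By; right].
    - by exists B; split=> //; [left | case: Ax => // Ax; right].
    by exists set0; split=> //; right.
  have CU A : F A \/ A = set0 -> is_cone (A `|` P) /\ A `|` P `<=` U `|` P.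
    case=> [FA|->]; last by split=> // x []//; right.
    by split; [apply: FC | move=> x [Ax|]; [left; exists A | right]].
  split; first by right; case: cP.
  - by move=> x y Ux Uy; have [A [/CU[[_ + _ _ _] sU] Ax Ay]] := two _ _ Ux Uy;
      move=> /(_ _ _ Ax Ay) /sU.
  - by move=> x y Ux Uy; have [A [/CU[[_ _ + _ _] sU] Ax Ay]] := two _ _ Ux Uy;
      move=> /(_ _ _ Ax Ay) /sU.
  - by move=> x y Ux Uy; have [A [/CU[[_ _ _ + _] sU] Ax Ay]] := two _ _ Ux Uy;
      move=> /(_ _ _ Ax Ay) /sU.
  by move=> x Ux Uy; have [A [/CU[[_ _ _ _ +] sU] Ax Ay]] := two _ _ Ux Uy;
      move=> /(_ _ Ax Ay).
have maxM Q : is_cone Q -> A `|` P `<=` Q -> Q `<=` A `|` P.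
  move=> cQ sQ x Qx; apply: contrapT => nx; apply: (maxA Q).
    by split; [move=> y Ay; apply: sQ; left | move=> /(_ x Qx) Ax; apply: nx; left].
  rewrite /C; suff -> : Q `|` P = Q by [].
  by apply/seteqP; split=> y; [case=> // Py; apply: sQ; right | left].
by exists (MaxCone CA maxM) => x Px; right.
Qed.

Variable M : max_cone.

Let M1 : M 1. Proof. by case: (max_coneP M). Qed.
Let MD x y : M x -> M y -> M (x + y). Proof. by case: (max_coneP M) => _ + _ _ _; apply. Qed.
Let MM x y : M x -> M y -> M (x * y). Proof. by case: (max_coneP M) => _ _ + _ _; apply. Qed.
Let MB2 x y : M x -> M y -> M ((x - y) ^+ 2).
Proof. by case: (max_coneP M) => _ _ _ + _; apply. Qed.
Let Manti x : M x -> M (- x) -> x = 0. Proof. by case: (max_coneP M) => _ _ _ _; apply. Qed.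
Let M0 : M 0. Proof. by rewrite -(mul0r 0) -(subrr 1) -expr2; apply: MB2. Qed.

Definition in_real : {pred L} :=
  fun x => `[< exists a b, [/\ M a, M b & x = a - b] >].

Lemma in_realP x : reflect (exists a b, [/\ M a, M b & x = a - b]) (x \in in_real).
Proof. exact: asboolP. Qed.

Lemma in_real_cone x : M x -> x \in in_real.
Proof. by move=> Mx; apply/in_realP; exists x, 0; split; rewrite ?subr0. Qed.

Let realB x y : x \in in_real -> y \in in_real -> x - y \in in_real.
Proof.
move=> /in_realP[a [b [Ma Mb ->]]] /in_realP[c [d [Mc Md ->]]].
apply/in_realP; exists (a + d), (b + c); split; try exact: MD.
by ring.
Qed.

Let realM x y : x \in in_real -> y \in in_real -> x * y \in in_real.
Proof.
move=> /in_realP[a [b [Ma Mb ->]]] /in_realP[c [d [Mc Md ->]]].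
apply/in_realP; exists (a * c + b * d), (a * d + b * c).
by split; [apply: MD; apply: MM .. | ring].
Qed.

Let real_sq x : x \in in_real -> M (x ^+ 2).
Proof. by case/in_realP=> a [b [Ma Mb ->]]; apply: MB2. Qed.

(** The fractions of members of [M] by nonzero real squares again form a cone containing [M], so
    maximality puts them in [M]. This makes [in_real] closed under inverses. *)
Let cone_div x s : M x -> s \in in_real -> M (x / s ^+ 2).
Proof.
move=> Mx Rs; have [->|s0] := eqVneq s 0; first by rewrite expr0n invr0 mulr0.
pose Q := [set u | exists y t, [/\ M y, t \in in_real, t != 0 & u = y / t ^+ 2]].
have R1 : 1 \in in_real by apply: in_real_cone.
suff cQ : is_cone Q.
  apply: (max_cone_max cQ); last by exists x, s.
  by move=> y My; exists y, 1; split; rewrite ?oner_eq0 // expr1n divr1.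
split.
- by exists 1, 1; split; rewrite ?oner_eq0 // expr1n divr1.
- move=> _ _ [y [t [My Rt t0 ->]]] [z [r [Mz Rr r0 ->]]].
  exists (y * r ^+ 2 + z * t ^+ 2), (t * r); split.
  + by apply: MD; apply: MM => //; apply: real_sq.
  + exact: realM.
  + by rewrite mulf_neq0.
  + by field; rewrite ?t0 ?r0 ?andbT.
- move=> _ _ [y [t [My Rt t0 ->]]] [z [r [Mz Rr r0 ->]]].
  exists (y * z), (t * r); split; [exact: MM|exact: realM|by rewrite mulf_neq0|].
  by field; rewrite ?t0 ?r0 ?andbT.
- move=> _ _ [y [t [My Rt t0 ->]]] [z [r [Mz Rr r0 ->]]].
  exists ((y * r ^+ 2 - z * t ^+ 2) ^+ 2), ((t * r) ^+ 2); split.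
  + by apply: MB2; apply: MM => //; apply: real_sq.
  + by rewrite expr2 realM ?realM.
  + by rewrite expf_neq0 ?mulf_neq0.
  + by field; rewrite ?t0 ?r0 ?andbT.
move=> _ [y [t [My Rt t0 ->]]] [z [r [Mz Rr r0 E]]].
have {}E : - (y * r ^+ 2) = z * t ^+ 2.
  transitivity (- (y / t ^+ 2) * (t ^+ 2 * r ^+ 2)); first by field.
  by rewrite E; field.
have : y * r ^+ 2 = 0.
  by apply: Manti; rewrite ?E; apply: MM => //; apply: real_sq.
by move/eqP; rewrite mulf_eq0 (negPf (expf_neq0 _ r0)) orbF => /eqP->; rewrite mul0r.
Qed.

Let realV x : x \in in_real -> x^-1 \in in_real.
Proof.
have [->|x0] := eqVneq x 0; first by rewrite invr0.
move=> Rx; have /in_realP[a [b [Ma Mb Ex]]] := Rx.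
apply/in_realP; exists (a / x ^+ 2), (b / x ^+ 2); split; try exact: cone_div.
by rewrite -mulrBl -Ex; field.
Qed.

(** If [- x] is not in [M], then M + M x is a cone, so by maximality it equals [M] and contains
    [x]. *)
Lemma cone_total x : x \in in_real -> M x \/ M (- x).
Proof.
move=> Rx; have [|nMx] := pselect (M (- x)); [by right | left].
pose Q := [set u | exists p q, [/\ M p, M q & u = p + q * x]].
suff cQ : is_cone Q.
  apply: (max_cone_max cQ); last by exists 0, 1; split; rewrite ?add0r ?mul1r.
  by move=> y My; exists y, 0; split; rewrite ?mul0r ?addr0.
split.
- by exists 1, 0; split; rewrite ?mul0r ?addr0.
- move=> _ _ [p [q [Mp Mq ->]]] [r [s [Mr Ms ->]]].
  by exists (p + r), (q + s); split; [exact: MD..|ring].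
- move=> _ _ [p [q [Mp Mq ->]]] [r [s [Mr Ms ->]]].
  exists (p * r + q * s * x ^+ 2), (p * s + q * r); split; last by ring.
    by apply: MD; [exact: MM | apply: MM; [exact: MM | exact: real_sq]].
  by apply: MD; apply: MM.
- move=> _ _ [p [q [Mp Mq ->]]] [r [s [Mr Ms ->]]].
  exists ((p + q * x - (r + s * x)) ^+ 2), 0; split=> //; last by rewrite mul0r addr0.
  have RC y : M y -> y \in in_real by exact: in_real_cone.
  apply: real_sq; have -> : p + q * x - (r + s * x) = (p - r) - (s - q) * x by ring.
  by apply: realB; rewrite ?realM //; apply: realB; apply: RC.
move=> _ [p [q [Mp Mq ->]]] [r [s [Mr Ms E]]].
have [b0|b0] := eqVneq (q + s) 0.
  have q0 : q = 0 by apply: Manti => //; rewrite -(addKr q s) b0 addr0 in Ms.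
  have s0 : s = 0 by rewrite q0 add0r in b0.
  move: E; rewrite q0 s0 !mul0r !addr0 => E.
  by rewrite (Manti Mp) // E.
(* Here p + qx and r + sx are opposite, so (q+s)x = -(p+r), and -x becomes a member of [M] divided
   by a square. *)
case: nMx; have Ex : - x = (p + r) * (q + s) / (q + s) ^+ 2.
  have Epr : p + r = - (q + s) * x.
    apply/eqP; rewrite -subr_eq0; apply/eqP.
    transitivity ((p + q * x) + (r + s * x)); first by ring.
    by rewrite -E subrr.
  by rewrite Epr; field.
rewrite Ex; apply: cone_div; last by apply: in_real_cone; apply: MD.
by apply: MM; apply: MD.
Qed.

Lemma in_real_divring_closed : divring_closed in_real.
Proof.
split; [by apply: in_real_cone|exact: realB|].
by move=> x y Rx Ry; apply: realM => //; apply: realV.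
Qed.

HB.instance Definition _ := GRing.isDivringClosed.Build L in_real
  in_real_divring_closed.

Record real_elt := RealElt { real_val :> L; _ : real_val \in in_real }.
HB.instance Definition _ := [isSub for real_val].
HB.instance Definition _ := [Choice of real_elt by <:].
HB.instance Definition _ := [SubChoice_isSubIntegralDomain of real_elt by <:].
HB.instance Definition _ := [SubIntegralDomain_isSubField of real_elt by <:].

Definition real_le (x y : real_elt) := `[< M (\val (y - x)) >].
Definition real_lt (x y : real_elt) := (y != x) && real_le x y.
Definition real_norm (x : real_elt) := if real_le 0 x then x else - x.

Lemma real_le0P x : reflect (M (\val x)) (real_le 0 x).
Proof. by rewrite /real_le subr0; apply: asboolP. Qed.

Let real_leN0P x : reflect (M (- \val x)) (real_le x 0).
Proof. by rewrite /real_le sub0r rmorphN; apply: asboolP. Qed.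

Let real_le0_add x y : real_le 0 x -> real_le 0 y -> real_le 0 (x + y).
Proof.
by move=> /real_le0P Mx /real_le0P My; apply/real_le0P; rewrite rmorphD; apply: MD.
Qed.

Let real_le0_mul x y : real_le 0 x -> real_le 0 y -> real_le 0 (x * y).
Proof.
by move=> /real_le0P Mx /real_le0P My; apply/real_le0P; rewrite rmorphM; apply: MM.
Qed.

Let real_le0_anti x : real_le 0 x -> real_le x 0 -> x = 0.
Proof.
move=> /real_le0P Mx /real_leN0P Nx; apply: val_inj.
by rewrite (Manti Mx Nx) rmorph0.
Qed.

Let real_sub_ge0 x y : real_le 0 (y - x) = real_le x y.
Proof. by rewrite /real_le subr0. Qed.

Let real_le0_total x : real_le 0 x || real_le x 0.
Proof.
apply/orP; case: (cone_total (valP x)) => Mx; [left|right].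
  exact/real_le0P.
exact/real_leN0P.
Qed.

Let real_normN x : real_norm (- x) = real_norm x.
Proof.
rewrite /real_norm opprK; have [Nx|Nx] := boolP (real_le 0 (- x)).
  have [Px|//] := boolP (real_le 0 x).
  suff -> : x = 0 by rewrite oppr0.
  by apply: real_le0_anti; rewrite // -real_sub_ge0 sub0r.
have := real_le0_total (- x); rewrite (negPf Nx) /= -real_sub_ge0 sub0r opprK.
by move=> ->.
Qed.

Let real_ge0_norm x : real_le 0 x -> real_norm x = x.
Proof. by rewrite /real_norm => ->. Qed.

Let real_ltE x y : real_lt x y = (y != x) && real_le x y.
Proof. by []. Qed.

HB.instance Definition _ := Num.IntegralDomain_isLeReal.Build real_elt
  real_le0_add real_le0_mul real_le0_anti real_sub_ge0 real_le0_total
  real_normN real_ge0_norm real_ltE.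

Lemma real_elt_ge0P (x : real_elt) : reflect (M (\val x)) (0 <= x).
Proof. exact: real_le0P. Qed.

Section Root.
Variables (p : {poly real_elt}) (a b : real_elt) (w : L).
Hypotheses (irr_p : irreducible_poly p) (pab : p.[a] * p.[b] < 0).
Hypothesis (pw : root (map_poly \val p) w).

Let E : {rmorphism {poly real_elt} -> L} :=
  horner_eval w \o map_poly (\val : {rmorphism real_elt -> L}).

Let Ep : E p = 0. Proof. exact/rootP. Qed.

Let E_inv q : p %| q \/ exists v, E v * E q = 1.
Proof.
have [cpq|ncpq] := boolP (coprimep p q); [right|left].
  have [[u v] /= /(congr1 E)] := Bezout_eq1_coprimepP _ _ cpq.
  by rewrite rmorphD !rmorphM rmorph1 Ep mulr0 add0r; exists v.
have := irr_p.2 _ ncpq (dvdp_gcdl p q).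
by move/eqp_dvdl <-; apply: dvdp_gcdr.
Qed.

Let EC c : E c%:P = \val c.
Proof. by rewrite -[LHS]/(map_poly _ _).[w] map_polyC hornerC. Qed.

Let E_sum_sq_neq s : (forall x, x \in s -> 0 <= x.1) -> E (1 + sum_sq s) != 0.
Proof.
move=> s0; apply/eqP => E0; case: (E_inv (1 + sum_sq s)).
  exact/negP/(sign_change_ndvd pab s0).
by case=> v; rewrite E0 mulr0 => /eqP; rewrite eq_sym oner_eq0.
Qed.

(* The values at w of weighted sums of squares of polynomials form a cone     *)
(* containing M, hence equal to M, and they already generate M(w).            *)
Lemma sign_change_root_real : w \in in_real.
Proof.
pose nneg (s : seq (real_elt * {poly real_elt})) := forall x, x \in s -> 0 <= x.1.
pose Q := [set u : L | exists2 s, nneg s & u = E (sum_sq s)].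
have nneg1 c q : 0 <= c -> nneg [:: (c, q)] by move=> c0 x; rewrite inE => /eqP->.
have sum1 c q : sum_sq [:: (c, q)] = c *: q ^+ 2 by rewrite /sum_sq big_seq1.
pose mul s t : seq (real_elt * {poly real_elt}) :=
  [seq (x.1 * y.1, x.2 * y.2) | x <- s, y <- t].
have nnegM s t : nneg s -> nneg t -> nneg (mul s t).
  by move=> s0 t0 x /allpairsP[[y z] /= [/s0 y0 /t0 z0 ->]]; apply: mulr_ge0.
have sumM s t : sum_sq (mul s t) = sum_sq s * sum_sq t.
  rewrite /sum_sq big_allpairs_dep mulr_suml; apply: eq_bigr => x _.
  rewrite mulr_sumr; apply: eq_bigr => y _ /=.
  by rewrite -scalerAl -scalerAr scalerA exprMn.
have QM x : M x -> Q x.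
  move=> Mx; pose c := RealElt (in_real_cone Mx).
  exists [:: (c, 1)]; first by apply: nneg1; apply/real_elt_ge0P.
  by rewrite sum1 expr1n alg_polyC EC.
have Qsq q : Q (E q ^+ 2).
  exists [:: (1, q)]; first exact: nneg1 ler01.
  by rewrite sum1 scale1r rmorphXn.
have cQ : is_cone Q.
  split; first by apply: QM.
  - move=> _ _ [s s0 ->] [t t0 ->]; exists (s ++ t).
      by move=> x; rewrite mem_cat => /orP[/s0|/t0].
    by rewrite /sum_sq big_cat rmorphD.
  - move=> _ _ [s s0 ->] [t t0 ->]; exists (mul s t); first exact: nnegM.
    by rewrite sumM rmorphM.
  - by move=> _ _ [s s0 ->] [t t0 ->]; rewrite -rmorphB; apply: Qsq.
  move=> u [s s0 Es] [t t0 Et]; apply: contrapT => /eqP u0.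
  case: (E_inv (sum_sq s)) => [/dvdpP[q Eq]|[v Ev]].
    by move/eqP: u0; rewrite Es Eq rmorphM Ep mulr0.
  (* With [v] inverse to u at w, this weighted sum of squares takes the value u(-u)v^2 = -1 at w, so
     adding 1 makes it vanish, against [E_sum_sq_neq]. *)
  pose r := mul (mul s t) [:: (1, v)].
  have r0 : nneg r := nnegM _ _ (nnegM _ _ s0 t0) (nneg1 1 v ler01).
  have /negP[] := E_sum_sq_neq r0.
  rewrite rmorphD rmorph1 !sumM sum1 scale1r !rmorphM -Et -Es.
  rewrite -Es in Ev; apply/eqP.
  transitivity (1 - (E v * u) ^+ 2); first by ring.
  by rewrite Ev expr1n subrr.
have sQ : Q `<=` (M : set L) by apply: (max_cone_max cQ).
have Rsq q : E q ^+ 2 \in in_real by apply: in_real_cone; apply: sQ.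
have EX : E 'X = w by rewrite -[LHS]/(map_poly _ _).[w] map_polyX hornerX.
have four : (4 : real_elt) != 0 by rewrite pnatr_eq0.
have val4 : \val (4 : real_elt) = 4 :> L by rewrite rmorph_nat.
have L4 : (4 : L) != 0 by rewrite -val4 fmorph_eq0.
(* Real squares of polynomial values suffice, since 4w = (w+1)^2 - (w-1)^2. *)
have -> : w = (E ('X + 1) ^+ 2 - E ('X - 1) ^+ 2) / 4.
  by rewrite !(rmorphD, rmorphB, rmorph1) EX; field.
by apply: rpred_div; [apply: rpredB | rewrite rpred_nat].
Qed.

End Root.

(** An irreducible polynomial that changes sign has a root in [L], which is real by
    [sign_change_root_real]; the polynomial is then linear and the root lies between the endpoints.
    A reducible one has a proper factor whose values at the endpoints do not have the same strict
    sign. *)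
Lemma real_elt_ivt : Num.real_closed_axiom real_elt.
Proof.
move=> p a b le_ab /andP[pa pb]; have : p.[a] * p.[b] <= 0 by rewrite mulr_le0_ge0.
have [n] := ubnP (size p); elim: n p {pa pb} => // n IHn p; rewrite ltnS => le_pn.
rewrite le_eqVlt mulf_eq0 => /orP[/orP[pa|pb]|pab].
- by exists a; rewrite // lexx.
- by exists b; rewrite // lexx le_ab.
have sp : (1 < size p)%N.
  rewrite ltnNge; apply: contraTN pab => /size1_polyC->.
  by rewrite !hornerC -leNgt -expr2 sqr_ge0.
have p0 : p != 0 by rewrite -size_poly_gt0 ltnW.
have [irr_p|nirr] := pselect (irreducible_poly p).
  have [w pw] : exists w, root (map_poly \val p) w.
    by apply/closed_rootP; rewrite size_map_poly gtn_eqF.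
  have Rw := sign_change_root_real irr_p pab pw.
  pose x := RealElt Rw.
  have px : root p x by rewrite -(fmorph_root (\val : {rmorphism real_elt -> L})).
  have /eqpP[[c d] /= /andP[c0 d0] Epx] : 'X - x%:P %= p.
    by apply: irr_p; rewrite ?size_XsubC // dvdp_XsubCl.
  exists x => //; have pE y : p.[y] = c / d * (y - x).
    have /(congr1 (fun q => q.[y])) := Epx.
    by rewrite !hornerZ hornerXsubC => E; rewrite mulrAC E mulrAC divff ?mul1r.
  move: pab; rewrite !pE mulrACA -expr2 => pab.
  have {pab} xab : (a - x) * (b - x) < 0.
    by rewrite -(pmulr_rlt0 _ (_ : 0 < (c / d) ^+ 2)) // exprn_even_gt0 ?mulf_neq0 ?invr_eq0.
  apply/andP; split; rewrite leNgt; apply: contraTN xab => lt_x; rewrite -leNgt.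
    by rewrite mulr_ge0 // subr_ge0 ltW // (lt_le_trans lt_x).
  by rewrite mulr_le0 // subr_le0 ltW // (le_lt_trans le_ab).
have [q [sq qp nqp]] : exists q : {poly real_elt}, [/\ size q != 1, q %| p & ~~ (q %= p)].
  apply: contrapT => nq; apply: nirr; split=> // q sq qp.
  by apply: contrapT => /negP nqp; apply: nq; exists q.
have lt_qp : (size q < size p)%N.
  by rewrite ltn_neqAle dvdp_leq // andbT dvdp_size_eqp.
have [r Ep] := dvdpP _ _ qp.
have q0 : q != 0 by apply: contraNneq p0 => q0; rewrite Ep q0 mulr0.
have r0 : r != 0 by apply: contraNneq p0 => r0; rewrite Ep r0 mul0r.
have lt_rp : (size r < size p)%N.
  have : (0 < size q)%N by rewrite size_poly_gt0.
  rewrite Ep size_mul //; case: (size q) sq => [|[|k]] // _ _.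
  by rewrite !addnS /= ltnS leq_addr.
move: pab; rewrite Ep !hornerM mulrACA => pab.
have [qab|qab] := lerP (q.[a] * q.[b]) 0.
  have [|x xab qx] := IHn q _ qab; first exact: leq_trans le_pn.
  by exists x; rewrite // rootM qx orbT.
have [||x xab rx] := IHn r; first exact: leq_trans le_pn.
  by rewrite -(pmulr_lle0 _ qab) ltW.
by exists x; rewrite // rootM rx.
Qed.

HB.instance Definition _ := Num.RealField_isClosed.Build real_elt real_elt_ivt.

End Cones.

(** * Realization of prime cones *)

(** These are the points of the real spectrum of [W]: the last field makes the support, where both a
    and -a lie in the cone, a prime ideal. *)
Record prime_cone (W : comNzRingType) := PrimeCone {
  prime_cone_set :> W -> Prop;
  prime_coneD : forall a b,
    prime_cone_set a -> prime_cone_set b -> prime_cone_set (a + b);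
  prime_coneM : forall a b,
    prime_cone_set a -> prime_cone_set b -> prime_cone_set (a * b);
  prime_cone_total : forall a, prime_cone_set a \/ prime_cone_set (- a);
  prime_coneN1 : ~ prime_cone_set (- 1);
  prime_cone_prime : forall a b,
    prime_cone_set (a * b) -> prime_cone_set (- (a * b)) ->
    prime_cone_set a /\ prime_cone_set (- a) \/
    prime_cone_set b /\ prime_cone_set (- b)
}.

Section RealizeCone.
Local Open Scope quotient_scope.
Variables (W : countComNzRingType) (C : prime_cone W).

Lemma prime_cone_sq a : C (a ^+ 2).
Proof.
by case: (prime_cone_total C a) => Ca; [|rewrite -sqrrN]; rewrite expr2; apply: prime_coneM.
Qed.

Lemma prime_cone1 : C 1. Proof. by rewrite -(expr1n _ 2); apply: prime_cone_sq. Qed.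

Lemma prime_cone0 : C 0. Proof. by rewrite -(mul0r 0) -expr2; apply: prime_cone_sq. Qed.

Definition cone_support : {pred W} := fun a => `[< C a /\ C (- a) >].

Lemma cone_supportP a : reflect (C a /\ C (- a)) (a \in cone_support).
Proof. exact: asboolP. Qed.

Lemma cone_support_idealr : idealr_closed cone_support.
Proof.
split.
- by apply/cone_supportP; rewrite oppr0; split; apply: prime_cone0.
- by apply/cone_supportP => -[_ /prime_coneN1].
move=> a u v /cone_supportP[Cu Cu'] /cone_supportP[Cv Cv'].
have [Ca|Ca] := prime_cone_total C a; apply/cone_supportP; rewrite opprD; split;
  apply: prime_coneD => //.
- exact: prime_coneM.
- by rewrite -mulrN; apply: prime_coneM.
- by rewrite -mulrNN; apply: prime_coneM.
- by rewrite -mulNr; apply: prime_coneM.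
Qed.

Lemma cone_support_prime : prime_idealr_closed cone_support.
Proof.
move=> u v /cone_supportP[Cuv /(prime_cone_prime Cuv)[]] uv; apply/orP.
  by left; apply/cone_supportP.
by right; apply/cone_supportP.
Qed.

HB.instance Definition _ := isIdealr.Build W cone_support cone_support_idealr.
HB.instance Definition _ := isPrimeIdealrClosed.Build W cone_support
  cone_support_prime.

Definition cone_quot := {ideal_quot cone_support}.
HB.instance Definition _ := GRing.ComNzRing.on cone_quot.

(** Units and inverses are chosen classically, to give the quotient the structure of an integral
    domain with inverses from which its fraction field is formed. *)
Definition cone_quot_unit : pred cone_quot := fun x => `[< exists y, y * x = 1 >].
Definition cone_quot_inv (x : cone_quot) : cone_quot :=
  if pselect (exists y, y * x = 1) is left h then projT1 (cid h) else x.

Let cone_quot_mulVr : {in cone_quot_unit, left_inverse 1 cone_quot_inv *%R}.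
Proof.
move=> x /asboolP xu; rewrite /cone_quot_inv.
by case: pselect => // h; case: cid.
Qed.

Let cone_quot_unitP x y : y * x = 1 -> cone_quot_unit x.
Proof. by move=> yx; apply/asboolP; exists y. Qed.

Let cone_quot_inv_out : {in [predC cone_quot_unit], cone_quot_inv =1 id}.
Proof.
by move=> x /negP xu; rewrite /cone_quot_inv; case: pselect => // h; case: xu; apply/asboolP.
Qed.

HB.instance Definition _ := GRing.ComNzRing_hasMulInverse.Build cone_quot
  cone_quot_mulVr cone_quot_unitP cone_quot_inv_out.
HB.instance Definition _ := GRing.ComUnitRing_isIntegral.Build cone_quot
  (@Quotient.rquot_IdomainAxiom W cone_support).
Let quot_reprK : cancel (repr : cone_quot -> W) \pi. Proof. exact: reprK. Qed.
HB.instance Definition _ := Choice_isCountable.Build cone_quot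
  (pcan_pickleK (can_pcan quot_reprK)).

Definition cone_frac := {fraction cone_quot}.
HB.instance Definition _ := GRing.Field.on cone_frac.
HB.instance Definition _ := [Countable of {ratio cone_quot} by <:].
Let frac_reprK : cancel (repr : cone_frac -> {ratio cone_quot}) \pi. Proof. exact: reprK. Qed.
HB.instance Definition _ := Choice_isCountable.Build cone_frac
  (pcan_pickleK (can_pcan frac_reprK)).

(** In an algebraic closure of the fraction field of [W] modulo the support, the image of [C] is a
    cone. Extended to a maximal one, it spans a real closed field that contains the image of [W],
    because [C] is total. *)
Theorem prime_cone_realization : exists (M : rcfType) (f : {rmorphism W -> M}),
  forall a, 0 <= f a <-> C a.
Proof.
have [L [i _]] := countable_algebraic_closure cone_frac.
pose pr : {rmorphism W -> cone_quot} := \pi.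
pose j : {rmorphism W -> L} :=
  i \o (@tofrac cone_quot : {rmorphism cone_quot -> cone_frac})
    \o pr.
have jE a : (j a == 0) = (a \in cone_support).
  rewrite -[a in RHS]subr0 Quotient.idealrBE.
  have -> : (j a == 0) = (@tofrac cone_quot (pr a) == 0).
    exact: fmorph_eq0.
  by rewrite tofrac_eq0 -[0 in LHS](rmorph0 pr).
pose P : set L := [set u | exists2 a, C a & u = j a].
have cP : is_cone P.
  split.
  - by exists 1; [apply: prime_cone1 | rewrite rmorph1].
  - by move=> _ _ [a Ca ->] [b Cb ->]; exists (a + b); rewrite ?rmorphD //; apply: prime_coneD.
  - by move=> _ _ [a Ca ->] [b Cb ->]; exists (a * b); rewrite ?rmorphM //; apply: prime_coneM.
  - move=> _ _ [a Ca ->] [b Cb ->]; exists ((a - b) ^+ 2); first exact: prime_cone_sq.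
    by rewrite rmorphXn rmorphB.
  move=> _ [a Ca ->] [b Cb Eab]; apply/eqP; rewrite jE.
  have /cone_supportP[_ Cab] : a + b \in cone_support by rewrite -jE rmorphD -Eab subrr.
  apply/cone_supportP; split=> //.
  have -> : - a = b + - (a + b) by rewrite opprD addrC addrNK.
  exact: prime_coneD.
have [M sPM] := max_cone_exists cP.
have Mj a : C a -> M (j a) by move=> Ca; apply: sPM; exists a.
have Rj a : j a \in in_real M.
  have [/Mj/in_real_cone//|/Mj/in_real_cone] := prime_cone_total C a.
  by rewrite rmorphN rpredN.
pose f a := RealElt (Rj a).
have fB : zmod_morphism f by move=> a b; apply: val_inj; rewrite [RHS]rmorphB; apply: (rmorphB j).
have fM : monoid_morphism f.
  split=> [|a b]; apply: val_inj; first by rewrite [RHS]rmorph1; apply: (rmorph1 j).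
  by rewrite [RHS]rmorphM; apply: (rmorphM j).
pose F : {rmorphism W -> real_elt M} := HB.pack f
  (GRing.isZmodMorphism.Build _ _ f fB) (GRing.isMonoidMorphism.Build _ _ f fM).
exists (real_elt M), F => a; split=> [/real_elt_ge0P /= Mja|/Mj Mja]; last exact/real_elt_ge0P.
(* If only -a were in [C], then j(a) and its opposite would both lie in [M], so a would be in the
   support and hence in [C]. *)
have [//|CNa] := prime_cone_total C a.
have /eqP : j a = 0.
  by case: (max_coneP M) => _ _ _ _; apply=> //; rewrite -rmorphN; apply: Mj.
by rewrite jE => /cone_supportP[].
Qed.
End RealizeCone.

(** * Compatible absolute values *)

Section AbsoluteValueTheory.
Variables (R : realType) (K : rcfType) (v : K -> R).
Hypotheses (v_abs : nonarch_abs v) (v_compat : order_compatible v).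

Lemma abs0 : v 0 = 0. Proof. exact/(nonarch_abs_eq0 v_abs). Qed.

Lemma abs_gt0 a : a != 0 -> 0 < v a.
Proof.
move=> /eqP a0; rewrite lt_neqAle nonarch_abs_ge0 // andbT eq_sym.
by apply/eqP => /(nonarch_abs_eq0 v_abs).
Qed.

Lemma abs1 : v 1 = 1.
Proof.
have v1 : v 1 != 0 by rewrite gt_eqF ?abs_gt0 ?oner_eq0.
by apply: (mulfI v1); rewrite -nonarch_absM // !mulr1.
Qed.

Lemma absN a : v (- a) = v a.
Proof.
apply/eqP; rewrite -(eqrXn2 (n := 2)) ?nonarch_abs_ge0 //.
by rewrite !expr2 -!nonarch_absM // mulrNN.
Qed.

Lemma abs_sgz a : sgz (signed_abs v a) = sgz a.
Proof.
rewrite /signed_abs; have [->|/abs_gt0 va] := eqVneq a 0.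
  by rewrite !sgz0 mul0r sgz0.
rewrite sgzM [sgz (v a)]gtr0_sgz // mulr1.
by case: (sgzP a) => _; rewrite ?sgz0 ?sgz1 ?rmorphN ?sgzN ?sgz1.
Qed.

Lemma signed_absM a b : signed_abs v (a * b) = signed_abs v a * signed_abs v b.
Proof. by rewrite /signed_abs sgzM rmorphM /= nonarch_absM // mulrACA. Qed.

Lemma signed_abs_gt0 a : 0 < a -> signed_abs v a = v a.
Proof. by move=> a0; rewrite /signed_abs gtr0_sgz // mul1r. Qed.

Lemma signed_absN a : signed_abs v (- a) = - signed_abs v a.
Proof. by rewrite /signed_abs sgzN rmorphN mulNr absN. Qed.

Lemma signed_abs_mono a b : a <= b -> signed_abs v a <= signed_abs v b.
Proof.
move=> le_ab; have [a0|a0] := lerP 0 a.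
  have b0 := le_trans a0 le_ab; have s0 c : 0 <= c -> signed_abs v c = v c.
    rewrite le_eqVlt => /predU1P[<-|/signed_abs_gt0//].
    by rewrite /signed_abs sgz0 mul0r abs0.
  by rewrite !s0 // v_compat.
have [b0|b0] := lerP 0 b.
  apply: (@le_trans _ _ 0).
    by rewrite -[_ <= 0]sgz_le0 abs_sgz sgz_le0 ltW.
  by rewrite -[0 <= _]sgz_ge0 abs_sgz sgz_ge0.
rewrite -[a]opprK -[b]opprK [leLHS]signed_absN [leRHS]signed_absN lerN2.
rewrite !signed_abs_gt0 ?oppr_gt0 //; apply: v_compat; first by rewrite oppr_ge0 ltW.
by rewrite lerN2.
Qed.

Lemma abs2 : v 2 = 1.
Proof.
apply/eqP; rewrite eq_le -[X in _ && (X <= _)]abs1 v_compat ?ler01 ?ler1n // andbT.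
by rewrite (le_trans (nonarch_absD v_abs _ _)) // abs1 maxxx.
Qed.

Lemma signed_abs2 a : signed_abs v (a *+ 2) = signed_abs v a.
Proof.
by rewrite -mulr_natr signed_absM [signed_abs v 2]signed_abs_gt0 ?ltr0n // abs2 mulr1.
Qed.

(** If a <= b then a + b <= 2b, and |2| = 1, so monotonicity alone gives the bound. *)
Lemma signed_absD_max a b :
  signed_abs v (a + b) <= Num.max (signed_abs v a) (signed_abs v b).
Proof.
wlog le_ab : a b / a <= b => [wl|].
  by case/orP: (le_total a b) => /wl //; rewrite addrC maxC.
apply: (@le_trans _ _ (signed_abs v (b *+ 2))).
  by rewrite signed_abs_mono // mulr2n lerD2r.
by rewrite signed_abs2 le_max lexx orbT.
Qed.

Lemma signed_absD_min a b :
  Num.min (signed_abs v a) (signed_abs v b) <= signed_abs v (a + b).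
Proof.
rewrite -lerN2 -signed_absN opprD oppr_min -!signed_absN; exact: signed_absD_max.
Qed.

Lemma abs_gt1_exists : nontrivial_abs v -> exists2 u, 0 < u & 1 < v u.
Proof.
case=> a [/eqP a0 /eqP va]; wlog a_gt0 : a a0 va / 0 < a => [wl|].
  have [/wl|lt_a0|a00] := ltgtP 0 a; [by apply|apply: (wl (- a))|by rewrite -a00 eqxx in a0].
  - by rewrite oppr_eq0.
  - by rewrite absN.
  by rewrite oppr_gt0.
have [lt_v1|lt_1v|/eqP] := ltgtP (v a) 1; last by rewrite (negPf va).
  exists a^-1; first by rewrite invr_gt0.
  by rewrite -(ltr_pM2l (abs_gt0 a0)) -nonarch_absM // divff // abs1 mulr1.
by exists a.
Qed.

(* Above the roots of absolute value at most 1 and below the square roots of  *)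
(* the others, no polynomial of the list changes sign.                        *)
Lemma sgz_constant_across_unit (hs : seq {poly K}) : nontrivial_abs v ->
  exists t0 t1, [/\ 0 < t0, v t0 <= 1, 0 < t1, 1 < v t1 &
    forall h, h \in hs -> sgz h.[t0] = sgz h.[t1]].
Proof.
move=> /abs_gt1_exists[u u0 vu].
pose rs := flatten [seq roots h (- cauchy_bound h) (cauchy_bound h) | h <- hs].
have [t0 [t0_gt0 vt0 lt_t0]] : exists t0, [/\ 0 < t0, v t0 <= 1 &
    forall r, r \in rs -> v r <= 1 -> r < t0].
  elim: rs => [|r s [t [t_gt0 vt lt_t]]]; first by exists 1; rewrite ltr01 abs1 lexx.
  have [vr|vr] := lerP (v r) 1; last first.
    exists t; split=> // c; rewrite inE => /predU1P[->|/lt_t//].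
    by rewrite leNgt vr.
  (* The ultrametric inequality keeps the absolute value at most 1 while the point moves past
     [r]. *)
  exists (Num.max r t + 1); split.
  - by rewrite ltr_pwDr // le_max (ltW t_gt0) orbT.
  - rewrite (le_trans (nonarch_absD v_abs _ _)) // abs1 ge_max lexx andbT.
    by case: (leP r t).
  move=> c; rewrite inE => /predU1P[->|/lt_t lt_c /lt_c {}lt_c].
    by rewrite ltr_pwDr // le_max lexx.
  by rewrite ltr_pwDr // le_max (ltW lt_c) orbT.
have [t1 [t1_gt0 vt1 lt_t1]] : exists t1, [/\ 0 < t1, 1 < v t1 &
    forall r, r \in rs -> 0 < r -> 1 < v r -> t1 < r].
  elim: rs {lt_t0} => [|r s [t [t_gt0 vt lt_t]]]; first by exists u.
  have [/andP[r0 vr]|nr] := boolP ((0 < r) && (1 < v r)); last first.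
    exists t; split=> // c; rewrite inE => /predU1P[->|/lt_t//] r0 vr.
    by rewrite r0 vr in nr.
  have lt_1r : 1 < r.
    by rewrite ltNge; apply: contraTN vr => le_r1; rewrite -leNgt -abs1 v_compat // ltW.
  have sr0 : 0 < Num.sqrt r by rewrite sqrtr_gt0.
  have lt_sr : Num.sqrt r < r.
    rewrite -[ltRHS]sqr_sqrtr ?(ltW r0) // expr2 ltr_pMr //.
    by rewrite -sqrtr1 ltr_sqrt // ltr01.
  have vsr : 1 < v (Num.sqrt r).
    rewrite ltNge; apply: contraTN vr => le_v1; rewrite -leNgt.
    by rewrite -(sqr_sqrtr (ltW r0)) expr2 nonarch_absM // mulr_ile1 ?nonarch_abs_ge0.
  exists (Num.min t (Num.sqrt r)); split.
  - by rewrite lt_min t_gt0.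
  - by case: (leP t (Num.sqrt r)).
  move=> c; rewrite inE => /predU1P[->|/lt_t lt_c c0 vc].
    by rewrite gt_min lt_sr orbT.
  by rewrite gt_min lt_c.
have le_t : t0 <= t1.
  rewrite leNgt; apply/negP => /ltW /(v_compat (ltW t1_gt0)).
  by rewrite leNgt (le_lt_trans vt0 vt1).
exists t0, t1; split=> // h hh; have [->|h0] := eqVneq h 0; first by rewrite !horner0.
apply: sgz_noroot => // c /andP[t0c ct1]; apply/negP => hc.
have crs : c \in rs.
  apply/flattenP; exists (roots h (- cauchy_bound h) (cauchy_bound h)).
    exact: (map_f (fun h => roots h (- cauchy_bound h) (cauchy_bound h))).
  by apply: root_in_roots => //; apply: root_in_cauchy_bound.
have [/(lt_t0 _ crs)|/(lt_t1 _ crs)] := lerP (v c) 1; first by rewrite ltNge t0c.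
by move=> /(_ (lt_le_trans t0_gt0 t0c)); rewrite ltNge ct1.
Qed.

End AbsoluteValueTheory.

(** * Approximation of signed seminorms by points *)

Lemma sgz_eq_le (R1 R2 : realDomainType) (a : R1) (b : R2) :
  (0 <= a) = (0 <= b) -> (a <= 0) = (b <= 0) -> sgz a = sgz b.
Proof.
have [a0|a0|<-] := ltgtP 0 a => [_|+ _|].
- by rewrite leNgt => /esym/negbFE b0; rewrite !gtr0_sgz.
- by rewrite leNgt => /esym/negbFE b0; rewrite !ltr0_sgz.
by move=> b0 b0'; rewrite (le_anti (_ : b <= 0 <= b)) ?sgz0 // -b0 -b0'.
Qed.

Section Lifting.
Variables (K : rcfType) (n : nat) (cs : seq K).
Local Notation N := (size cs).
Local Notation L := (n + N.+1)%N.

(* The variables stand for the constants in cs, the parameter t and the       *)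
(* coordinates of 'rV[K]_n, in this order.                                    *)
Definition coeff_env (t : K) (i : nat) : K := if (i < N)%N then cs`_i else t.

Definition poly_env (t : K) (i : nat) : {mpoly K[n]} :=
  if (i < N.+1)%N then (coeff_env t i)%:MP
  else if insub (i - N.+1)%N is Some j then 'X_j else 0.

(** One [p] serves every [t]: it is evaluated at t1 for the seminorm and at t0 for the point of
    K^n. *)
Definition liftable (g : {mpoly K[n]}) :=
  exists p : int_poly L, forall t, int_eval (poly_env t) L p = g.

Lemma poly_env_coeff t i : (i < N.+1)%N -> poly_env t i = (coeff_env t i)%:MP.
Proof. by rewrite /poly_env => ->. Qed.

Lemma poly_env_coord t (j : 'I_n) : poly_env t (N.+1 + j)%N = 'X_j.
Proof.
by rewrite /poly_env ltnNge leq_addr /= addKn valK.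
Qed.

Lemma liftable_const c : c \in cs -> liftable c%:MP.
Proof.
move=> c_cs; have lt_cN : (index c cs < N)%N by rewrite index_mem.
exists (int_var L (index c cs)) => t.
rewrite int_eval_var; last by rewrite (leq_trans (leqW lt_cN)) ?leq_addl.
by rewrite poly_env_coeff ?leqW // /coeff_env lt_cN nth_index.
Qed.

Lemma liftableX j : liftable 'X_j.
Proof.
exists (int_var L (N.+1 + j)) => t; rewrite int_eval_var ?poly_env_coord //.
by rewrite [(n + _)%N]addnC ltn_add2l.
Qed.

Lemma liftableD g h : liftable g -> liftable h -> liftable (g + h).
Proof.
by move=> [p gp] [q hq]; exists (p + q) => t; rewrite rmorphD gp hq.
Qed.

Lemma liftableM g h : liftable g -> liftable h -> liftable (g * h).
Proof.
by move=> [p gp] [q hq]; exists (p * q) => t; rewrite rmorphM gp hq.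
Qed.

Lemma liftable_mpoly g : (forall m, m \in msupp g -> g@_m \in cs) -> liftable g.
Proof.
move=> gcs; rewrite [g]mpolyE big_seq.
apply: (big_ind liftable) => [||m /gcs g_m]; first by exists 0 => t; rewrite rmorph0.
  exact: liftableD.
rewrite -mul_mpolyC; apply: liftableM; first exact: liftable_const.
rewrite mpolyXE_id; apply: (big_ind liftable) => [||i _].
- by exists 1 => t; rewrite rmorph1.
- exact: liftableM.
elim: (m i) => [|k IHk]; first by exists 1 => t; rewrite rmorph1.
by rewrite exprS; apply: liftableM => //; apply: liftableX.
Qed.

Lemma int_eval_parameter t : int_eval (poly_env t) L (int_var L N) = t%:MP.
Proof.
rewrite int_eval_var; last by rewrite addnS ltnS leq_addl.
by rewrite poly_env_coeff // /coeff_env ltnn.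
Qed.
End Lifting.

Section SeminormOnPolynomials.
Variables (R : realType) (K : rcfType) (v : K -> R).
Hypotheses (v_abs : nonarch_abs v) (v_compat : order_compatible v).
Variables (n : nat) (X : set 'rV[K]_n) (x : coord_ring X -> R).
Hypothesis xP : signed_seminorm v x.

Definition poly_seminorm (g : {mpoly K[n]}) : R := x (coord_proj X g).
Local Notation y := poly_seminorm.

Lemma poly_seminormC c : y c%:MP = signed_abs v c.
Proof. exact: signed_seminorm_const. Qed.

Lemma poly_seminormM g h : y (g * h) = y g * y h.
Proof.
rewrite /y coord_projM.
exact: (signed_seminormM xP (coord_proj X g) (coord_proj X h)).
Qed.

Lemma poly_seminormD_min g h : Num.min (y g) (y h) <= y (g + h).
Proof. by rewrite /y coord_projD; apply: (signed_seminormD_min xP). Qed.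

Lemma poly_seminormD_max g h : y (g + h) <= Num.max (y g) (y h).
Proof. by rewrite /y coord_projD; apply: (signed_seminormD_max xP). Qed.

Lemma poly_seminormN g : y (- g) = - y g.
Proof.
rewrite -mulN1r -(rmorphN1 (mpolyC n (R := K))) poly_seminormM poly_seminormC.
by rewrite signed_absN // signed_abs_gt0 // abs1 // mulN1r.
Qed.

(** Write g = (g - h) + h; the maximum bounding the value of g cannot be the value of h, so it is
    that of g - h. This turns comparisons of values into signs. *)
Lemma poly_seminorm_gt_sub g h : y h < y g -> 0 < y g -> 0 < y (g - h).
Proof.
move=> lt_hg g0; have := poly_seminormD_max (g - h) h.
by rewrite subrK le_max (leNgt _ (y h)) lt_hg orbF; apply: lt_le_trans.
Qed.

(** The lower bound on sums gives additivity, and primeness holds because values multiply in the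
    field [R]. *)
Lemma seminorm_prime_cone (W : comNzRingType) (f : {rmorphism W -> {mpoly K[n]}}) :
  exists C : prime_cone W, forall a, C a <-> 0 <= y (f a).
Proof.
have CD a b : 0 <= y (f a) -> 0 <= y (f b) -> 0 <= y (f (a + b)).
  move=> a0 b0; rewrite rmorphD; apply: le_trans (poly_seminormD_min _ _).
  by rewrite le_min a0.
have CM a b : 0 <= y (f a) -> 0 <= y (f b) -> 0 <= y (f (a * b)).
  by move=> a0 b0; rewrite rmorphM poly_seminormM mulr_ge0.
have Ct a : 0 <= y (f a) \/ 0 <= y (f (- a)).
  by rewrite rmorphN poly_seminormN oppr_ge0; apply/orP/le_total.
have CN1 : ~ 0 <= y (f (- 1)).
  rewrite rmorphN rmorph1 poly_seminormN -(rmorph1 (mpolyC n (R := K))).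
  by rewrite poly_seminormC signed_abs_gt0 // abs1 // oppr_ge0 leNgt ltr01.
have Cp a b : 0 <= y (f (a * b)) -> 0 <= y (f (- (a * b))) ->
    (0 <= y (f a) /\ 0 <= y (f (- a))) \/ (0 <= y (f b) /\ 0 <= y (f (- b))).
  rewrite !rmorphN rmorphM !poly_seminormN poly_seminormM !oppr_ge0 => ab0 ab0'.
  have /eqP : y (f a) * y (f b) = 0 by apply/le_anti; rewrite ab0 ab0'.
  by rewrite mulf_eq0 => /orP[/eqP->|/eqP->]; [left|right].
by exists (PrimeCone CD CM Ct CN1 Cp).
Qed.

(* The real closed field realizing x sees the parameter t1, whereas K sees    *)
(* t0; the polynomials eliminated from gs and us do not tell them apart.      *)
Lemma seminorm_approx (gs : seq {mpoly K[n]}) (us : seq ({mpoly K[n]} * {mpoly K[n]})) :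
  nontrivial_abs v ->
  exists t0 t1 (a : 'rV[K]_n), [/\ 0 < t0, v t0 <= 1, 0 < t1, 1 < v t1 &
    (forall g, g \in gs -> sgz (y g) = sgz g.@[a 0]) /\
    forall u, u \in us ->
      sgz (y (t1%:MP * u.1 - u.2)) = sgz (t0 * u.1.@[a 0] - u.2.@[a 0])].
Proof.
move=> v_nontrivial.
pose all_polys := gs ++ map fst us ++ map snd us.
pose cs : seq K := flatten [seq [seq g@_m | m <- msupp g] | g <- all_polys].
pose N := size cs; pose L := (n + N.+1)%N.
have /choice[lift liftP] : forall g, exists p : int_poly L, g \in all_polys ->
    forall t, int_eval (poly_env n cs t) L p = g.
  move=> g; have [gG|] := boolP (g \in all_polys); last by exists 0.
  have [|p gp] := @liftable_mpoly K n cs g; last by exists p.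
  move=> m mg; apply/flattenP; exists [seq g@_m | m <- msupp g]; last exact: map_f.
  exact: (map_f (fun g : {mpoly K[n]} => [seq g@_m | m <- msupp g])).
pose G : seq (int_poly L) := map lift gs ++
  [seq int_var L N * lift u.1 - lift u.2 | u <- us].
have [H trH] := @transfer N.+1 n G.
(* The parameter is the outermost remaining variable, so substituting the constants leaves
   univariate polynomials in it. The 0 is a dummy, never read below index [N]. *)
pose hs := [seq map_poly (int_eval (coeff_env cs 0) N) (h : {poly int_poly N}) | h <- H].
have [t0 [t1 [t0_gt0 vt0 t1_gt0 vt1 hst]]] :=
  sgz_constant_across_unit v_abs v_compat hs v_nontrivial.
have evH t h : int_eval (coeff_env cs t) N.+1 h =
    (map_poly (int_eval (coeff_env cs 0) N) (h : {poly int_poly N})).[t].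
  rewrite int_evalS; congr (_.[_]); last by rewrite /coeff_env ltnn.
  by apply: eq_map_poly; apply: eq_int_eval => i lt_i; rewrite /coeff_env lt_i.
have [C CP] := seminorm_prime_cone (int_eval (poly_env n cs t1) L).
have [M [f fP]] := prime_cone_realization C.
have sgz_f p : sgz (f p) = sgz (y (int_eval (poly_env n cs t1) L p)).
  have := CP p; have := CP (- p); rewrite -!fP !rmorphN poly_seminormN !oppr_ge0.
  case=> n1 n2 [p1 p2].
  have E1 : (0 <= f p) = (0 <= y (int_eval (poly_env n cs t1) L p)) by apply/idP/idP.
  have E2 : (f p <= 0) = (y (int_eval (poly_env n cs t1) L p) <= 0) by apply/idP/idP.
  exact: sgz_eq_le.
pose e1 := f \o int_var L.
have fE p : f p = int_eval e1 L p := rmorphism_int_eval f p.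
have [|e ee eG] := trH M K e1 (coeff_env cs t0).
  (* Under x an eliminated polynomial is the constant h(cs, t1) of K, whose sign x preserves; [hst]
     then exchanges t1 for t0. *)
  move=> h hH; pose h' := int_eval (int_var L) N.+1 h.
  have -> : int_eval e1 N.+1 h = f h' by rewrite rmorph_int_eval.
  rewrite sgz_f rmorph_int_eval evH hst; last exact: map_f.
  rewrite -evH -(abs_sgz v_abs) -poly_seminormC; congr (sgz (y _)).
  rewrite (rmorph_int_eval (mpolyC n (R := K))); apply: eq_int_eval => i lt_i /=.
  rewrite int_eval_var ?poly_env_coeff //.
  by rewrite (leq_trans lt_i) // leq_addl.
pose a : 'rV[K]_n := \row_j e (N.+1 + j)%N.
have ea p : int_eval e L p = (int_eval (poly_env n cs t0) L p).@[a 0].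
  rewrite (rmorph_int_eval (meval (a 0))); apply: eq_int_eval => i lt_i /=.
  have [lt_iN|le_Ni] := ltnP i N.+1.
    by rewrite poly_env_coeff // mevalC ee.
  have lt_in : (i - N.+1 < n)%N by rewrite ltn_subLR // addnC.
  have -> : i = (N.+1 + Ordinal lt_in)%N by rewrite /= subnKC.
  by rewrite poly_env_coord mevalXU mxE.
have key p : p \in G -> sgz (y (int_eval (poly_env n cs t1) L p)) =
    sgz (int_eval (poly_env n cs t0) L p).@[a 0].
  by move=> pG; rewrite -sgz_f fE eG // ea.
exists t0, t1, a; split=> //; split=> [g gg|u uu].
  have gG : g \in all_polys by rewrite mem_cat gg.
  by rewrite -{1}(liftP g gG t1) key ?liftP // mem_cat map_f.
have u1G : u.1 \in all_polys by rewrite !mem_cat map_f ?orbT.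
have u2G : u.2 \in all_polys by rewrite !mem_cat (map_f snd uu) ?orbT.
have := key (int_var L N * lift u.1 - lift u.2).
rewrite !rmorphB !rmorphM !int_eval_parameter !liftP //= mevalC; apply.
by rewrite mem_cat (map_f (fun u => int_var L N * lift u.1 - lift u.2)) ?orbT.
Qed.

End SeminormOnPolynomials.

(** * The theorem *)

Section Descriptions.
Variables (K : rcfType) (n : nat).
Implicit Types (D : description K n) (sg : {mpoly K[n]} -> int).

Definition conj_description D1 D2 : description K n :=
  [seq c1 ++ c2 | c1 <- D1, c2 <- D2].

Definition neg_atom (c : {mpoly K[n]} * int) : description K n :=
  [seq [:: (c.1, e)] | e <- [seq e <- [:: -1; 0; 1] | e != c.2]].

Definition neg_description D : description K n :=
  foldr (fun c => conj_description (flatten (map neg_atom c))) [:: [::]] D.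

Lemma satisfies_conj sg D1 D2 :
  satisfies sg (conj_description D1 D2) = satisfies sg D1 && satisfies sg D2.
Proof.
apply/hasP/andP => [[_ /allpairsP[[c1 c2] /= [D1c D2c ->]]]|[/hasP[c1 D1c s1] /hasP[c2 D2c s2]]].
  by rewrite all_cat => /andP[s1 s2]; split; apply/hasP; [exists c1|exists c2].
by exists (c1 ++ c2); [apply: allpairs_f | rewrite all_cat s1].
Qed.

Lemma satisfies_neg sg D : (forall f, sg f \in [:: -1; 0; 1]) ->
  satisfies sg (neg_description D) = ~~ satisfies sg D.
Proof.
move=> sgP; elim: D => //= c D IHD; rewrite satisfies_conj IHD negb_or; congr (_ && _).
rewrite {D IHD}; elim: c => //= a c; rewrite negb_and => <-.
rewrite /satisfies has_cat; congr (_ || _).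
apply/hasP/idP => [[_ /mapP[e + ->]]|sa].
  by rewrite mem_filter /= andbT => /andP[ne _] /eqP ->.
exists [:: (a.1, sg a.1)]; last by rewrite /= eqxx.
by apply: (map_f (fun e => [:: (a.1, e)])); rewrite mem_filter sa sgP.
Qed.

Lemma describes_exists (S : set 'rV[K]_n) :
  semialgebraic S -> exists D : description K n, describes D S.
Proof.
elim=> [f|{}S _ [D ->]|S1 S2 _ [D1 ->] _ [D2 ->]].
- exists [:: [:: (f, 1)]]; apply/seteqP; split=> a;
    by rewrite /satisfies /= orbF andbT sgz_cp0.
- exists (neg_description D); apply/seteqP; split=> a /=;
    rewrite satisfies_neg; try (by move/negP); try (by move=> f; case: sgzP).
- exists (D1 ++ D2); apply/seteqP; split=> a /=;
    by rewrite /satisfies has_cat => /orP.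
Qed.

Lemma eq_satisfies sg sg' D : (forall c, c \in flatten D -> sg c.1 = sg' c.1) ->
  satisfies sg D = satisfies sg' D.
Proof.
move=> sgE; apply: eq_in_has => s Ds; apply: eq_in_all => c sc.
by rewrite sgE //; apply/flattenP; exists s.
Qed.
End Descriptions.

Section EvaluationSeminorm.
Variables (R : realType) (K : rcfType) (v : K -> R).
Hypotheses (v_abs : nonarch_abs v) (v_compat : order_compatible v).
Variables (n : nat) (X : set 'rV[K]_n) (a : 'rV[K]_n).
Hypothesis Xa : X a.

Lemma coord_evalD (f g : coord_ring X) :
  coord_eval (f + g) a = coord_eval f a + coord_eval g a.
Proof.
rewrite -[f in LHS]coord_reprK -[g in LHS]coord_reprK -coord_projD.
by rewrite coord_eval_proj // mevalD.
Qed.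

Lemma coord_evalM (f g : coord_ring X) :
  coord_eval (f * g) a = coord_eval f a * coord_eval g a.
Proof. by rewrite [LHS]coord_eval_proj // mevalM. Qed.

Lemma coord_eval_seminorm :
  signed_seminorm v (fun f : coord_ring X => signed_abs v (coord_eval f a)).
Proof.
split=> [c|f g|f g|f g].
- by rewrite coord_eval_proj // mevalC.
- by rewrite coord_evalM signed_absM.
- by rewrite coord_evalD signed_absD_min.
- by rewrite coord_evalD signed_absD_max.
Qed.
End EvaluationSeminorm.

Theorem theorem6p2 (R : realType) (K : rcfType) (v : K -> R)
    (v_abs : nonarch_abs v) (v_compat : order_compatible v)
    (v_nontrivial : nontrivial_abs v)
    (n : nat) (S : set 'rV[K]_n) (S_semialgebraic : semialgebraic S)
    (m : nat) (F : 'I_m -> coord_ring (zariski_closure S)) :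
  (trop_an F @` real_analytification v S) `&`
    [set y : 'rV[R]_m | forall j, range (signed_abs v) (y 0 j)]
  = trop_pt v F @` S.
Proof.
apply/seteqP; split=> [y [[x [xP [D SD Dx]] <-] /= yR]|_ [a Sa <-]].
  have /choice[c cF] : forall j, exists c, signed_abs v c = x (F j).
    by move=> j; case: (yR j) => c _; rewrite mxE; exists c.
  pose r j : {mpoly K[n]} := repr (F j).
  have yr j : poly_seminorm x (r j) = signed_abs v (c j).
    by rewrite cF /poly_seminorm coord_reprK.
  pose gs := map fst (flatten D) ++ [seq r j | j <- enum 'I_m].
  (* The bounds t^-1 < f_j / c_j < t, cleared of denominators by multiplying with c_j^2: c_j^2 < t
     c_j f_j and c_j f_j < t c_j^2. *)
  pose us := [seq ((c j)%:MP * r j, (c j * c j)%:MP) | j <- enum 'I_m] ++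
             [seq ((c j * c j)%:MP, (c j)%:MP * r j) | j <- enum 'I_m].
  have [t0 [t1 [a [t0_gt0 vt0 t1_gt0 vt1 [gsE usE]]]]] :=
    seminorm_approx v_abs v_compat xP gs us v_nontrivial.
  exists a.
    rewrite SD /=; move: Dx.
    rewrite (@eq_satisfies _ _ _ (fun f => sgz f.@[a 0])) // => d dD.
    by apply: gsE; rewrite mem_cat map_f.
  apply/rowP => j; rewrite !mxE -cF /coord_eval -/(r j).
  set b := (r j).@[a 0].
  have sb : sgz (c j) = sgz b.
    rewrite -(abs_sgz v_abs) -yr gsE // mem_cat; apply/orP; right.
    by apply: map_f; rewrite mem_enum.
  rewrite /signed_abs sb; congr (_ * _).
  have [c0|c0] := eqVneq (c j) 0.
    by move/eqP: sb; rewrite c0 sgz0 eq_sym sgz_eq0 => /eqP->.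
  have vc0 := abs_gt0 v_abs c0.
  have cc0 : 0 < c j * c j by rewrite -expr2 exprn_even_gt0.
  have cb0 : 0 < c j * b.
    by rewrite -sgz_gt0 sgzM -sb -sgzM sgz_gt0.
  have ycc : poly_seminorm x (c j * c j)%:MP = v (c j) * v (c j).
    by rewrite (poly_seminormC xP) signed_abs_gt0 // nonarch_absM.
  have ycr : poly_seminorm x ((c j)%:MP * r j) = v (c j) * v (c j).
    rewrite (poly_seminormM xP) yr (poly_seminormC xP) -signed_absM //.
    by rewrite signed_abs_gt0 // nonarch_absM.
  have yt g : poly_seminorm x (t1%:MP * g) = v t1 * poly_seminorm x g.
    by rewrite (poly_seminormM xP) (poly_seminormC xP) signed_abs_gt0.
  have vv0 : 0 < v (c j) * v (c j) by rewrite mulr_gt0.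
  have vv1 : v (c j) * v (c j) < v t1 * (v (c j) * v (c j)) by rewrite ltr_pMl.
  have pos u : u \in us -> poly_seminorm x u.1 = v (c j) * v (c j) ->
      poly_seminorm x u.2 = v (c j) * v (c j) -> u.2.@[a 0] < t0 * u.1.@[a 0].
    move=> /usE E u1 u2; rewrite -subr_gt0 -sgz_gt0 -E sgz_gt0.
    by apply: (poly_seminorm_gt_sub xP); rewrite yt u1 ?u2 //; apply: lt_trans vv1.
  (* Here |t0| <= 1 turns an order inequality into one of absolute values without loss; used in both
     directions, it gives |c_j b| = |c_j|^2. *)
  have bound p q : 0 < p -> 0 < q -> p < t0 * q -> v p <= v q.
    move=> p0 q0 /ltW /(v_compat _ _ (ltW p0)) /le_trans; apply.
    by rewrite nonarch_absM // ler_piMl // nonarch_abs_ge0.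
  apply/le_anti/andP; split.
    have := pos ((c j * c j)%:MP, (c j)%:MP * r j) _ ycc ycr.
    rewrite /= mevalM !mevalC -/b => lt_cb.
    rewrite -(ler_pM2l vc0) -!(nonarch_absM v_abs); apply: bound => //; apply: lt_cb.
    by rewrite mem_cat; apply/orP; right; apply: map_f; rewrite mem_enum.
  have := pos ((c j)%:MP * r j, (c j * c j)%:MP) _ ycr ycc.
  rewrite /= mevalM !mevalC -/b => lt_cb.
  rewrite -(ler_pM2l vc0) -!(nonarch_absM v_abs); apply: bound => //; apply: lt_cb.
  by rewrite mem_cat; apply/orP; left; apply: map_f; rewrite mem_enum.
have Xa : zariski_closure S a by move=> p; apply.
split; last by move=> j /=; rewrite mxE; exists (coord_eval (F j) a).
exists (fun f => signed_abs v (coord_eval f a)); last by apply/rowP => j; rewrite !mxE.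
split; first exact: coord_eval_seminorm.
have [D SD] := describes_exists S_semialgebraic.
exists D => //; move: Sa; rewrite {1}SD /=.
rewrite (@eq_satisfies _ _ _ (fun f => sgz f.@[a 0])) // => c _.
by rewrite abs_sgz // coord_eval_proj.
Qed.
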